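(* Let $n\ge 1$ be an integer and let $h(z)=\sum_{m=0}^\infty h_mz^m$ and $f(z)=\sum_{m=0}^\infty f_mz^m$ be analytic in a neighbourhood of $z=0$, with $f_0\ne 0$ and such that for every $m\ge 0$, $h_m=0$ implies $f_m=0$. Let $r_m$, $H_n$, $\lambda_k$ and $R_n$ be as defined in the context. Suppose additionally that $|h_m|\le 1$ for all $m=n+1,n+2,\dots$. Then the following holds. (a) Let $n\ge 2$. If $|r_m|\le\frac{|r_0|}{n}a^m$ for all $m=1,2,\dots$ and some $a\ge 0$, then (i) $\max_{k=1,\dots,n}|\lambda_k|\le(1+\varepsilon_n)a$; (ii) in the disk $|z|<(1+\varepsilon_n)^{-1}a^{-1}$ the sum $H_n(z)$ is analytic and $$|R_n(z)|\le\frac{2|r_0|n^2|az|^{n+1}}{1-(1+\varepsilon_n)a|z|};$$ (iii) if these assumptions hold, with the same $f$, $h$ and $a$, for all sufficiently large $n$, then $H_n(z)\to f(z)$ as $n\to\infty$ uniformly for $|z|<a^{-1}$. (b) If $|r_m|\le\frac{|r_0|}{n}\gamma m a^m$ for all $m=1,2,\dots$ and some $\gamma>0$ and $a\ge 0$, then (i) $\max_{k=1,\dots,n}|\lambda_k|\le(1+2\gamma)a$; (ii) in the disk $|z|<(1+2\gamma)^{-1}a^{-1}$ the sum $H_n(z)$ is analytic and $$|R_n(z)|\le\frac{2|r_0||(1+2\gamma)az|^{n+1}}{(1-(1+2\gamma)a|z|)^2},\qquad n\ge 2;$$ (iii) if these assumptions hold, with the same $f$, $h$, $\gamma$ and $a$,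 for all sufficiently large $n$, then $H_n(z)\to f(z)$ as $n\to\infty$ uniformly for $|z|<(1+2\gamma)^{-1}a^{-1}$.
   Context: The numbers $r_m=r_m(f,h)$ are defined by $r_m=0$ if $f_m=0$ and $r_m=f_m/h_m$ if $f_m\ne 0$, $m=0,1,\dots$. The family $\Lambda_n=\{\lambda_k\}_{k=1}^n$ of complex numbers is the unique (up to permutation) solution of the system $\sum_{k=1}^n\lambda_k^m=\frac{n}{r_0}r_m$, $m=1,\dots,n$. The interpolating sum is $H_n(z)=\frac{r_0}{n}\sum_{k=1}^n h(\lambda_kz)$, and $R_n(z)=f(z)-H_n(z)$ (one has $R_n(z)=O(z^{n+1})$ as $z\to0$). Functions $f$ and $h$ are identified with the sums of their power series wherever these converge. For $n\ge 2$, $\varepsilon_n:=\frac{2(\ln n-\ln\ln n)}{n}$. If $a=0$, a disk of radius $a^{-1}$ times a positive constant is understood as the whole plane. *)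

(* Defs.v *)
(* Library: Stdlib reals and Coquelicot; C is Coquelicot's type of complex numbers. *)
From Stdlib Require Import Reals List RList.
From Coquelicot Require Import Coquelicot.

Open Scope R_scope.

(* F is analytic at w when it is the sum of a power series in (z - w) near w. *)
Definition analytic_at (F : C -> C) (w : C) : Prop :=
  exists (c : nat -> C) (rho : R), 0 < rho /\
    forall z : C, Cmod (z - w)%C < rho ->
      is_pseries (K := C_AbsRing) (V := C_NormedModule) c (z - w)%C (F z).

Definition analytic_on (D : C -> Prop) (F : C -> C) : Prop :=
  forall w : C, D w -> analytic_at F w.

(* F is analytic near 0 with Taylor coefficients c, and F agrees with the sum of
   its power series wherever that series converges.  The values of F at the
   points of divergence are left arbitrary, so a statement about all such F
   cannot depend on them. *)
Definition sum_of_power_series (c : nat -> C) (F : C -> C) : Prop :=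
  (exists rho : R, 0 < rho /\
     forall z : C, Cmod z < rho ->
       is_pseries (K := C_AbsRing) (V := C_NormedModule) c z (F z)) /\
  (forall z l : C,
     is_pseries (K := C_AbsRing) (V := C_NormedModule) c z l -> F z = l).

Definition r_coef (fc hc : nat -> C) (m : nat) : C :=
  if Ceq_dec (fc m) 0 then 0%C else (fc m / hc m)%C.

(* The family Lambda_n is lam 1, ..., lam n; other values of lam are irrelevant. *)
Definition is_Lambda (fc hc : nat -> C) (n : nat) (lam : nat -> C) : Prop :=
  forall m : nat, (1 <= m <= n)%nat ->
    sum_n_m (G := C_AbelianMonoid) (fun k => (lam k ^ m)%C) 1 n
    = (INR n / r_coef fc hc 0 * r_coef fc hc m)%C.

Definition H_sum (fc hc : nat -> C) (h : C -> C) (n : nat) (lam : nat -> C)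
    (z : C) : C :=
  (r_coef fc hc 0 / INR n
   * sum_n_m (G := C_AbelianMonoid) (fun k => h (lam k * z)) 1 n)%C.

Definition R_rem (fc hc : nat -> C) (f h : C -> C) (n : nat) (lam : nat -> C)
    (z : C) : C :=
  (f z - H_sum fc hc h n lam z)%C.

Definition max_Cmod (n : nat) (lam : nat -> C) : R :=
  MaxRlist (map (fun k => Cmod (lam k)) (seq 1 n)).

Definition eps_ (n : nat) : R := 2 * (ln (INR n) - ln (ln (INR n))) / INR n.

(* The disk |z| < s / a, which is the whole plane when a = 0. *)
Definition disk (s a : R) (z : C) : Prop := a <> 0 -> Cmod z < s * / a.

Definition unif_cvg_on (D : C -> Prop) (F : nat -> C -> C) (g : C -> C) : Prop :=
  forall e : R, 0 < e -> exists N : nat, forall n : nat, (N <= n)%nat ->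
    forall z : C, D z -> Cmod (F n z - g z)%C < e.

Definition tail_le1 (hc : nat -> C) (n : nat) : Prop :=
  forall m : nat, (n + 1 <= m)%nat -> Cmod (hc m) <= 1.

Definition r_bound_a (fc hc : nat -> C) (n : nat) (a : R) : Prop :=
  forall m : nat, (1 <= m)%nat ->
    Cmod (r_coef fc hc m) <= Cmod (r_coef fc hc 0) / INR n * a ^ m.

Definition r_bound_b (fc hc : nat -> C) (n : nat) (gamma a : R) : Prop :=
  forall m : nat, (1 <= m)%nat ->
    Cmod (r_coef fc hc m)
    <= Cmod (r_coef fc hc 0) / INR n * gamma * INR m * a ^ m.

(* Main.v *)
Require Import Defs.
From Stdlib Require Import Reals List RList Lra Lia Psatz.
From Stdlib Require Import IndefiniteDescription.
From Coquelicot Require Import Coquelicot.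

Open Scope R_scope.

(** Write [s_m] for the power sum of the [lam k] of exponent [m].  The defining
    system turns a bound on [r_m] into a bound on [s_m] for [1 <= m <= n]: it
    gives [|s_m| <= a^m] in part (a) and [|s_m| <= gamma m a^m] in part (b).
    Everything rests on locating the [lam k] from these [n] inequalities.
    Dividing by one [lam k] reduces this to showing that 1 is not a root of
    [p(X) = prod_k (1 - mu k X)] when the power sums of the [mu k] are small;
    by Newton's identities, [p] is the truncation at degree [n] of
    [exp (- sum_(i <= n) s_i X^i / i)].

    In part (b), with [|s_m| <= gamma m r^m] and [r = 1 / (1 + 2 gamma)],
    Newton's identities give [W <= (1 + W) (gamma sum_(i <= n) r^i)] for
    [W = sum_(1 <= m <= n) |p_m|], where the last factor is less than [1/2].
    Hence [W < 1 = p_0] and [p(1)] is not 0 ([no_unit_root_linear]).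

    In part (a), with [|s_m| <= r^m], let [e] and [e'] be the exponentials of
    [-+ sum_(i <= n) s_i X^i / i].  Both are dominated by
    [exp (sum_(i <= n) (r X)^i / i)], whose coefficients are [f_m r^m] with
    [f_m <= 1] and [f_(n+j) <= (n / (n + 1))^j] ([exp_majorant]).  If
    [p(1) = 0], then [e(1)] consists of the terms beyond degree [n], so
    [1 = e(1) e'(1)] is at most
    [n r^(n+1) / ((1 + n (1 - r)) (1 - r))].  Thus 1 is not a root as soon as
    [n r^(n+1) < (1 - r) (1 + n (1 - r))] ([no_unit_root_geometric]).  For
    [r = 1 / (1 + eps_ n)] this inequality is [eps_condition]: numerical lower
    bounds for [eps_ n] settle [n <= 15], and elementary bounds for the
    logarithm settle [n >= 16].

    Once [|lam k| <= B], the Taylor coefficients of [H_n] are [O(B^m)], which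
    gives analyticity on [B |z| < 1] by re-expansion of a power series
    ([analytic_at_of_pseries]).  The Taylor polynomials of [f] and [H_n] of degree [n]
    coincide, so the remainder is a sum over [m > n] bounded by a geometric
    series ([remainder_le]).

    Finally, a bound on [r_m] that carries the factor [1 / n] for all large [n]
    forces [r_m = 0] for [m >= 1].  Then all [lam k] vanish and
    [H_n = f = f_0], which yields both convergence statements
    ([H_sum_eq_of_constant]). *)

(** * Formal power series over C *)

(** Cauchy product of two sequences of coefficients, by recursion on the degree
    so that associativity is a structural induction. *)
Fixpoint conv (a b : nat -> C) (m : nat) : C :=
  match m with
  | O => (a O * b O)%C
  | S p => (a O * b m + conv (fun i => a (S i)) b p)%C
  end.

(** Partial sum [a 0 + .. + a n] of a complex sequence. *)
Definition csum (a : nat -> C) (n : nat) : C := sum_n (G := C_AbelianMonoid) a n.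

Lemma csum_S (a : nat -> C) (n : nat) :
  csum a (S n)
  = (csum a n + a (S n))%C.
Proof. exact (sum_Sn (G := C_AbelianMonoid) a n). Qed.

Lemma csum_0 (a : nat -> C) : csum a 0 = a O.
Proof. exact (sum_O (G := C_AbelianMonoid) a). Qed.

Lemma sum_1_0 (u : nat -> C) :
  sum_n_m (G := C_AbelianMonoid) u 1 0 = RtoC 0.
Proof. exact (sum_n_m_zero (G := C_AbelianMonoid) u 1 0 Nat.lt_0_1). Qed.

Lemma sum_1_S (u : nat -> C) (n : nat) :
  sum_n_m (G := C_AbelianMonoid) u 1 (S n)
  = (sum_n_m (G := C_AbelianMonoid) u 1 n + u (S n))%C.
Proof. exact (sum_n_Sm (G := C_AbelianMonoid) u 1 n ltac:(lia)). Qed.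

Lemma csum_ext (a b : nat -> C) (n : nat) :
  (forall i, (i <= n)%nat -> a i = b i) -> csum a n = csum b n.
Proof. exact (sum_n_ext_loc (G := C_AbelianMonoid) a b n). Qed.

Lemma conv_S (a b : nat -> C) (m : nat) :
  conv a b (S m) = (a O * b (S m) + conv (fun i => a (S i)) b m)%C.
Proof. reflexivity. Qed.

Lemma conv_ext (a a' b b' : nat -> C) (m : nat) :
  (forall i, (i <= m)%nat -> a i = a' i) -> (forall i, (i <= m)%nat -> b i = b' i) ->
  conv a b m = conv a' b' m.
Proof.
  revert a a'; induction m as [|m IH]; intros a a' Ha Hb; simpl.
  - rewrite Ha, Hb by lia; reflexivity.
  - rewrite Ha, Hb by lia. f_equal. apply IH; intros; [apply Ha | apply Hb]; lia.
Qed.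

Lemma conv_plus_l (a b c : nat -> C) (m : nat) :
  conv (fun i => (a i + b i)%C) c m = (conv a c m + conv b c m)%C.
Proof.
  revert a b; induction m as [|m IH]; intros a b; simpl; [ring|].
  rewrite (IH (fun i => a (S i)) (fun i => b (S i))). ring.
Qed.

Lemma conv_scal_l (k : C) (a b : nat -> C) (m : nat) :
  conv (fun i => (k * a i)%C) b m = (k * conv a b m)%C.
Proof.
  revert a; induction m as [|m IH]; intros a; simpl; [ring|].
  rewrite (IH (fun i => a (S i))). ring.
Qed.

Lemma conv_scal_r (k : C) (a b : nat -> C) (m : nat) :
  conv a (fun i => (k * b i)%C) m = (k * conv a b m)%C.
Proof.
  revert a; induction m as [|m IH]; intros a; simpl; [ring|]. rewrite IH. ring.
Qed.

Lemma conv_S_r (a b : nat -> C) (m : nat) :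
  conv a b (S m) = (conv a (fun i => b (S i)) m + a (S m) * b O)%C.
Proof.
  revert a; induction m as [|m IH]; intros a; [simpl; ring|].
  rewrite conv_S, (IH (fun i => a (S i))), (conv_S a (fun i => b (S i))). ring.
Qed.

Lemma conv_comm (a b : nat -> C) (m : nat) : conv a b m = conv b a m.
Proof.
  revert a b; induction m as [|m IH]; intros a b; [simpl; ring|].
  rewrite conv_S, conv_S_r, IH. ring.
Qed.

Lemma conv_assoc (a b c : nat -> C) (m : nat) :
  conv (conv a b) c m = conv a (conv b c) m.
Proof.
  revert a; induction m as [|m IH]; intros a; [simpl; ring|].
  rewrite (conv_S (conv a b)), (conv_S a).
  rewrite (conv_ext _ (fun i => (a O * b (S i) + conv (fun i => a (S i)) b i)%C) c c)
    by reflexivity.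
  rewrite conv_plus_l, conv_scal_l, IH, (conv_S b c). simpl. ring.
Qed.

(** The Euler derivation [X d/dX] obeys the Leibniz rule. *)
Lemma conv_euler (a b : nat -> C) (m : nat) :
  (RtoC (INR m) * conv a b m
   = conv (fun i => (RtoC (INR i) * a i)%C) b m
     + conv a (fun i => (RtoC (INR i) * b i)%C) m)%C.
Proof.
  revert a; induction m as [|m IH]; intros a; [simpl; ring|].
  rewrite !conv_S.
  rewrite (conv_ext (fun i => (RtoC (INR (S i)) * a (S i))%C)
     (fun i => (RtoC (INR i) * a (S i) + a (S i))%C) b b).
  2:{ intros i _. rewrite S_INR, RtoC_plus. ring. }
  2: reflexivity.
  rewrite conv_plus_l.
  replace (RtoC (INR (S m))) with (RtoC (INR m) + 1)%C
    by (rewrite S_INR, RtoC_plus; reflexivity).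
  pose proof (IH (fun i => a (S i))) as H.
  replace ((RtoC (INR m) + 1) * (a O * b (S m) + conv (fun i => a (S i)) b m))%C
   with ((RtoC (INR m) + 1) * a O * b (S m) + conv (fun i => a (S i)) b m
      + RtoC (INR m) * conv (fun i => a (S i)) b m)%C by ring.
  rewrite H. simpl (INR 0). ring.
Qed.

(** Coefficients of [1 / (1 - X)]; multiplying by it forms partial sums. *)
Definition geom : nat -> C := fun _ => 1%C.
Lemma sum_as_conv (a : nat -> C) (M : nat) :
  csum a M = conv a geom M.
Proof.
  induction M as [|M IH]; [rewrite csum_0; unfold geom; simpl; ring|].
  rewrite csum_S, IH, conv_S_r.  unfold geom; ring. 
Qed.

Lemma sum_conv (a b : nat -> C) (M : nat) :
  csum (conv a b) M
  = conv a (csum b) M.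
Proof.
  rewrite sum_as_conv, conv_assoc. apply conv_ext; [reflexivity|].
  intros i _. symmetry; apply sum_as_conv.
Qed.

Lemma conv_sum (a b : nat -> C) (m : nat) :
  conv a b m = csum (fun i => (a i * b (m - i)%nat)%C) m.
Proof.
  revert b; induction m as [|m IH]; intros b; [rewrite csum_0; reflexivity|].
  rewrite conv_S_r, IH, csum_S, Nat.sub_diag. f_equal.
  apply csum_ext. intros i Hi. replace (S m - i)%nat with (S (m - i)) by lia. reflexivity.
Qed.

(** * Elementary symmetric functions and Newton's identities *)

(** Coefficients of the polynomial [1 - l X]. *)
Definition lin (l : C) (m : nat) : C :=
  match m with O => 1%C | 1%nat => (- l)%C | _ => 0%C end.

(** Coefficients of [prod_(k = 1 .. n) (1 - mu k X)]. *)
Fixpoint lin_prod (mu : nat -> C) (n : nat) : nat -> C :=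
  match n with
  | O => fun m => match m with O => 1%C | S _ => 0%C end
  | S p => conv (lin (mu n)) (lin_prod mu p)
  end.

(** The power sums of [mu 1, .., mu n] as a formal power series with zero
    constant term. *)
Definition power_sum (mu : nat -> C) (n m : nat) : C :=
  match m with
  | O => 0%C
  | S _ => sum_n_m (G := C_AbelianMonoid) (fun k => (mu k ^ m)%C) 1 n
  end.

Lemma conv_lin (l : C) (q : nat -> C) (m : nat) :
  conv (lin l) q (S m) = (q (S m) - l * q m)%C.
Proof.
  rewrite conv_S. simpl (lin l 0).
  assert (H : forall p (a : nat -> C), (forall i, a (S i) = 0%C) ->
    conv a q p = (a O * q p)%C).
  { intros p; induction p as [|p IHp]; intros a Ha; [reflexivity|].
    rewrite conv_S, IHp by (intros; apply Ha). rewrite Ha. ring. }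
  rewrite H by reflexivity. simpl. ring.
Qed.

Lemma lin_prod_S (mu : nat -> C) (n : nat) :
  lin_prod mu (S n) = conv (lin (mu (S n))) (lin_prod mu n).
Proof. reflexivity. Qed.

Lemma lin_prod_0 (mu : nat -> C) (n : nat) : lin_prod mu n 0 = 1%C.
Proof. induction n as [|n IH]; [reflexivity|]. simpl. rewrite IH. ring. Qed.

Lemma lin_prod_high (mu : nat -> C) (n m : nat) : (n < m)%nat -> lin_prod mu n m = 0%C.
Proof.
  revert m; induction n as [|n IH]; intros [|m] H; try lia; [reflexivity|].
  rewrite lin_prod_S. rewrite conv_lin, !IH by lia. ring.
Qed.

Lemma power_sum_S (mu : nat -> C) (n m : nat) :
  power_sum mu (S n) (S m) = (power_sum mu n (S m) + mu (S n) ^ (S m))%C.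
Proof.
  apply (sum_1_S (fun k => (mu k ^ S m)%C)).
Qed.

Lemma newton_identities (mu : nat -> C) (n m : nat) :
  (RtoC (INR m) * lin_prod mu n m = - conv (power_sum mu n) (lin_prod mu n) m)%C.
Proof.
  revert m; induction n as [|n IH]; intros m.
  - assert (H : conv (power_sum mu 0) (lin_prod mu 0) m = 0%C).
    { rewrite (conv_ext _ (fun i => (0 * 0)%C) _ (lin_prod mu 0)); [|intros [|i] _|reflexivity].
      - rewrite (conv_scal_l 0 (fun _ => 0%C)). ring.
      - simpl; ring.
      - unfold power_sum. rewrite sum_1_0. ring. }
    rewrite H. destruct m; simpl; ring.
  - set (l := mu (S n)).
    set (g := fun i : nat => match i return C with O => 0%C | S _ => (l ^ i)%C end).
    assert (Hg : forall i, (RtoC (INR i) * lin l i = - conv g (lin l) i)%C).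
    { intros [|i]; [simpl; ring|]. rewrite conv_comm, conv_lin.
      destruct i as [|[|i]]; unfold g; simpl; ring. }
    rewrite lin_prod_S. fold l. rewrite conv_euler.
    rewrite (conv_ext _ (fun i => (-(1) * conv g (lin l) i)%C) (lin_prod mu n) (lin_prod mu n));
      [|intros; rewrite Hg; ring|reflexivity].
    rewrite (conv_ext (lin l) (lin l) (fun i => (RtoC (INR i) * lin_prod mu n i)%C)
       (fun i => (-(1) * conv (power_sum mu n) (lin_prod mu n) i)%C));
      [|reflexivity|intros; rewrite IH; ring].
    rewrite conv_scal_l, conv_scal_r, conv_assoc.
    rewrite <- (conv_assoc (lin l)).
    rewrite (conv_ext (conv (lin l) (power_sum mu n)) (conv (power_sum mu n) (lin l))
      (lin_prod mu n) (lin_prod mu n)); [|intros; apply conv_comm|reflexivity].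
    rewrite conv_assoc.
    rewrite (conv_ext (power_sum mu (S n)) (fun i => (g i + power_sum mu n i)%C)
       (conv (lin l) (lin_prod mu n)) (conv (lin l) (lin_prod mu n)));
      [|intros [|i] _; [simpl; ring|rewrite power_sum_S; unfold g, l; ring]|reflexivity].
    rewrite conv_plus_l. ring.
Qed.

Lemma sum_conv_lin (l : C) (q : nat -> C) (M : nat) :
  csum (conv (lin l) q) (S M)
  = (q (S M) + (1 - l) * csum q M)%C.
Proof.
  induction M as [|M IH].
  - rewrite csum_S, !csum_0, conv_lin. simpl. ring.
  - rewrite csum_S, IH, conv_lin, (csum_S q). ring.
Qed.

(** If some [mu k] equals 1, then 1 is a root of [prod_k (1 - mu k X)]. *)
Lemma lin_prod_root (mu : nat -> C) (n k M : nat) :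
  (1 <= k <= n)%nat -> mu k = 1%C -> (n <= M)%nat ->
  csum (lin_prod mu n) M = 0%C.
Proof.
  intros Hk H1. revert M; induction n as [|n IH]; intros M HM; [lia|].
  destruct M as [|M]; [lia|]. rewrite lin_prod_S. rewrite sum_conv_lin.
  rewrite lin_prod_high by lia.
  destruct (Nat.eq_dec k (S n)) as [->|Hne].
  - rewrite H1. ring.
  - rewrite IH by lia. ring.
Qed.

(** * Majorants *)

Lemma Cmod_csum_le (a : nat -> C) (n : nat) :
  Cmod (csum a n) <= sum_f_R0 (fun i => Cmod (a i)) n.
Proof.
  induction n as [|n IH]; [rewrite csum_0; simpl; lra|].
  rewrite csum_S, tech5.
  eapply Rle_trans; [apply Cmod_triangle|]. lra.
Qed.

Lemma csum_decomp (a : nat -> C) (n : nat) :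
  csum a (S n) = (a O + csum (fun i => a (S i)) n)%C.
Proof.
  induction n as [|n IH]; [rewrite csum_S, !csum_0; reflexivity|].
  rewrite csum_S, IH, (csum_S (fun i => a (S i))). ring.
Qed.

Lemma Cmod_conv_le (a b : nat -> C) (m : nat) :
  Cmod (conv a b m) <= sum_f_R0 (fun i => Cmod (a i) * Cmod (b (m - i)%nat)) m.
Proof.
  rewrite conv_sum. eapply Rle_trans; [apply Cmod_csum_le|].
  apply sum_Rle. intros i _. rewrite Cmod_mult. lra.
Qed.

Lemma sum_triangle (A B : nat -> R) (n : nat) :
  sum_f_R0 (fun m => sum_f_R0 (fun i => A i * B (m - i)%nat) m) n
  = sum_f_R0 (fun i => A i * sum_f_R0 B (n - i)) n.
Proof.
  induction n as [|n IH]; [reflexivity|].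
  rewrite tech5, IH, !tech5, <- Rplus_assoc, <- sum_plus, Nat.sub_diag.
  f_equal. apply sum_eq. intros i Hi.
  replace (S n - i)%nat with (S (n - i)) by lia. rewrite tech5. ring.
Qed.

Lemma sum_nonneg (A : nat -> R) (n : nat) :
  (forall i, 0 <= A i) -> 0 <= sum_f_R0 A n.
Proof. intros H; apply cond_pos_sum; exact H. Qed.

Lemma sum_f_R0_mono (A : nat -> R) (m n : nat) :
  (forall i, 0 <= A i) -> (m <= n)%nat -> sum_f_R0 A m <= sum_f_R0 A n.
Proof.
  intros H Hmn; induction Hmn as [|n Hmn IH]; [lra|]. rewrite tech5.
  specialize (H (S n)). lra.
Qed.

Lemma sum_cauchy_product_le (A B : nat -> R) (n : nat) :
  (forall i, 0 <= A i) -> (forall i, 0 <= B i) ->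
  sum_f_R0 (fun m => sum_f_R0 (fun i => A i * B (m - i)%nat) m) n
  <= sum_f_R0 A n * sum_f_R0 B n.
Proof.
  intros HA HB. rewrite sum_triangle, Rmult_comm, scal_sum.
  apply sum_Rle. intros i Hi. apply Rmult_le_compat_l; [apply HA|].
  apply sum_f_R0_mono; [exact HB|lia].
Qed.

(** If the power sums satisfy [|s_m| <= g m r^m] for [1 <= m <= n] and
    [g (r + .. + r^n) < 1/2], then [sum_(m = 1 .. n) |p_m| < 1] for the
    coefficients [p_m] of [prod_k (1 - mu k X)], so that 1 is not a root. *)
Lemma no_unit_root_linear (mu : nat -> C) (n : nat) (g r : R) :
  0 <= g -> 0 <= r ->
  sum_f_R0 (fun i => match i with O => 0 | S _ => g * r ^ i end) n < 1 / 2 ->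
  (forall m, (1 <= m <= n)%nat -> Cmod (power_sum mu n m) <= g * INR m * r ^ m) ->
  forall k, (1 <= k <= n)%nat -> mu k <> 1%C.
Proof.
  intros Hg Hr Hsum Hs k Hk H1.
  pose proof (lin_prod_root mu n k n Hk H1 (le_n n)) as Hroot.
  set (t := fun i => match i with O => 0 | S _ => g * r ^ i end) in *.
  set (p := lin_prod mu n) in *.
  assert (Ht : forall i, 0 <= t i).
  { intros [|i]; unfold t; [lra|]. apply Rmult_le_pos; [lra|apply pow_le; lra]. }
  assert (Hp : forall m, (1 <= m <= n)%nat ->
     Cmod (p m) <= sum_f_R0 (fun i => t i * Cmod (p (m - i)%nat)) m).
  { intros m Hm. assert (Hm0 : 0 < INR m) by (apply lt_0_INR; lia).
    apply Rmult_le_reg_l with (INR m); [exact Hm0|].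
    replace (INR m * Cmod (p m)) with (Cmod (RtoC (INR m) * p m)).
    2:{ rewrite Cmod_mult, Cmod_R, Rabs_pos_eq by lra. reflexivity. }
    unfold p. rewrite newton_identities, Cmod_opp. fold p.
    eapply Rle_trans; [apply Cmod_conv_le|]. rewrite scal_sum.
    apply sum_Rle. intros [|i] Hi.
    - simpl power_sum. rewrite Cmod_0. unfold t. lra.
    - specialize (Hs (S i) ltac:(lia)). unfold t.
      assert (INR (S i) <= INR m) by (apply le_INR; lia).
      assert (0 <= g * r ^ S i) by (apply (Ht (S i))).
      assert (0 <= Cmod (p (m - S i)%nat)) by apply Cmod_ge_0.
      assert (Cmod (power_sum mu n (S i)) <= (g * r ^ S i) * INR m) by nra.
      nra. }
  set (V := sum_f_R0 (fun m => Cmod (p m)) n).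
  assert (Hp0 : Cmod (p O) = 1) by (unfold p; rewrite lin_prod_0; apply Cmod_1).
  destruct n as [|n]; [lia|].
  assert (Hsplit : V = 1 + sum_f_R0 (fun m => Cmod (p (S m))) n).
  { unfold V. rewrite decomp_sum by lia. simpl pred. rewrite Hp0. reflexivity. }
  assert (HV1 : V - 1 <= sum_f_R0 t (S n) * V).
  { eapply Rle_trans;
      [|apply (sum_cauchy_product_le t (fun m => Cmod (p m)) (S n) Ht);
        intros; apply Cmod_ge_0].
    rewrite Hsplit. rewrite (decomp_sum _ (S n)) by lia. simpl pred.
    assert (0 <= sum_f_R0 (fun i => t i * Cmod (p (0 - i)%nat)) 0)
      by (simpl; lra).
    assert (sum_f_R0 (fun m => Cmod (p (S m))) n <=
      sum_f_R0 (fun i => sum_f_R0 (fun j => t j * Cmod (p (S i - j)%nat)) (S i)) n)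
      by (apply sum_Rle; intros m Hm; apply Hp; lia).
    lra. }
  assert (HV2 : 2 <= V).
  { assert (csum p (S n) = p O + csum (fun m => p (S m)) n)%C as Hd.
    { apply csum_decomp. }
    assert (Cmod (p O) <= sum_f_R0 (fun m => Cmod (p (S m))) n).
    { replace (p O) with (- csum (fun m => p (S m)) n)%C.
      - rewrite Cmod_opp. apply Cmod_csum_le.
      - change (csum p (S n) = RtoC 0) in Hroot. rewrite Hroot in Hd.
        transitivity (p O - (p O + csum (fun m => p (S m)) n))%C; [ring|].
        rewrite <- Hd. ring. }
    lra. }
  nra.
Qed.

(** * The exponential majorant *)

(** Course-of-values recursion on sequences. *)
Lemma sequence_rec {T : Type} (x0 : T) (step : nat -> (nat -> T) -> T) :
  (forall m u v, (forall i, (i <= m)%nat -> u i = v i) -> step m u = step m v) ->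
  exists e : nat -> T, e O = x0 /\ forall m, e (S m) = step m e.
Proof.
  intros Hext.
  set (approx := fix approx (k : nat) : nat -> T :=
    match k with
    | O => fun _ => x0
    | S k' => fun m => if Nat.leb m k' then approx k' m else step k' (approx k')
    end).
  assert (Happ : forall k m, approx (S k) m
    = if Nat.leb m k then approx k m else step k (approx k)) by reflexivity.
  assert (Hst : forall k i, (i <= k)%nat -> approx k i = approx i i).
  { intros k; induction k as [|k IH]; intros i Hi.
    - replace i with O by lia. reflexivity.
    - destruct (Nat.eq_dec i (S k)) as [->|Hne]; [reflexivity|].
      rewrite Happ. destruct (Nat.leb_spec i k); [apply IH; lia|lia]. }
  exists (fun m => approx m m). split; [reflexivity|]. intros m.
  rewrite Happ. destruct (Nat.leb_spec (S m) m); [lia|].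
  apply Hext. intros i Hi. apply Hst. exact Hi.
Qed.

(** For [s 0 = 0] there is a power series [e = exp (c sum_i s_i X^i / i)],
    characterised by [e 0 = 1] and [X de/dX = c s e]. *)
Lemma exp_series_exists (c : C) (s : nat -> C) :
  s O = 0%C ->
  exists e : nat -> C, e O = 1%C /\
    forall m, (RtoC (INR m) * e m = c * conv s e m)%C.
Proof.
  intros Hs.
  destruct (sequence_rec (T := C) 1%C
    (fun m u => c * conv (fun i => s (S i)) u m / RtoC (INR (S m)))%C) as [e [He0 He]].
  { intros m u v Huv. do 2 f_equal. apply conv_ext; [reflexivity|exact Huv]. }
  exists e. split; [exact He0|]. intros [|m].
  - simpl conv. rewrite Hs. simpl INR. ring.
  - rewrite He, conv_S, Hs. field.
    intros H. apply RtoC_inj in H. apply (not_0_INR (S m)); [lia|exact H].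
Qed.

(** Sum of the first [k] terms; [prefix u m - prefix u (m - n)] is the sum of
    the last [n] of the first [m] terms, or of all of them if [m < n]. *)
Fixpoint prefix (u : nat -> R) (k : nat) : R :=
  match k with O => 0 | S p => prefix u p + u p end.

Lemma prefix_ext (u v : nat -> R) (k : nat) :
  (forall i, (i < k)%nat -> u i = v i) -> prefix u k = prefix v k.
Proof.
  induction k as [|k IH]; intros H; simpl; [reflexivity|].
  rewrite IH, H by (intros; try apply H; lia). reflexivity.
Qed.

Lemma prefix_window_lower (u : nat -> R) (x : R) (k d : nat) :
  (forall i, (k <= i < k + d)%nat -> x <= u i) ->
  INR d * x <= prefix u (k + d) - prefix u k.
Proof.
  induction d as [|d IH]; intros H; [rewrite Nat.add_0_r; simpl; lra|].
  rewrite Nat.add_succ_r, S_INR. simpl.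
  specialize (IH ltac:(intros; apply H; lia)). specialize (H (k + d)%nat ltac:(lia)). lra.
Qed.

Lemma prefix_window_upper (u : nat -> R) (x : R) (k d : nat) :
  (forall i, (k <= i < k + d)%nat -> u i <= x) ->
  prefix u (k + d) - prefix u k <= INR d * x.
Proof.
  induction d as [|d IH]; intros H; [rewrite Nat.add_0_r; simpl; lra|].
  rewrite Nat.add_succ_r, S_INR. simpl.
  specialize (IH ltac:(intros; apply H; lia)). specialize (H (k + d)%nat ltac:(lia)). lra.
Qed.

Lemma sum_window (w : nat -> R) (n m : nat) :
  sum_f_R0 (fun i => if andb (Nat.leb 1 i) (Nat.leb i n) then w (m - i)%nat else 0) m
  = prefix w m - prefix w (m - n).
Proof.
  enough (H : forall N, (N <= m)%nat ->
    sum_f_R0 (fun i => if andb (Nat.leb 1 i) (Nat.leb i n) then w (m - i)%nat else 0) N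
    = prefix w m - prefix w (m - Nat.min N n)).
  { rewrite H by lia. do 2 f_equal. lia. }
  induction N as [|N IH]; intros HN.
  - simpl. rewrite Nat.sub_0_r. ring.
  - rewrite tech5, IH by lia. destruct (Nat.leb_spec 1 (S N)); [|lia].
    destruct (Nat.leb_spec (S N) n) as [H'|H']; simpl andb.
    + replace (m - Nat.min N n)%nat with (S (m - S N)) by lia.
      replace (Nat.min (S N) n) with (S N) by lia. simpl. ring.
    + replace (Nat.min (S N) n) with (Nat.min N n) by lia. ring.
Qed.

(** The coefficients of [exp (sum_(i = 1 .. n) X^i / i)]: they lie
    between 0 and 1 and decay geometrically beyond degree [n].  The recurrence is the
    one for the logarithmic derivative, and it yields
    [(m + 1) f_(m+1) = (m + 1) f_m - f_(m-n)] for [m >= n]. *)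
Lemma exp_majorant (n : nat) :
  (1 <= n)%nat ->
  exists f : nat -> R,
    f O = 1 /\
    (forall m, (1 <= m)%nat -> INR m * f m = prefix f m - prefix f (m - n)) /\
    (forall m, 0 <= f m <= 1) /\
    (forall j, f (n + j)%nat <= (INR n / (INR n + 1)) ^ j).
Proof.
  intros Hn.
  destruct (sequence_rec 1
    (fun m u => (prefix u (S m) - prefix u (S m - n)) / INR (S m))) as [f [Hf0 Hf]].
  { intros m u v Huv.
    rewrite (prefix_ext u v (S m)), (prefix_ext u v (S m - n)); [reflexivity| |];
      intros; apply Huv; lia. }
  assert (Hrec : forall m, (1 <= m)%nat -> INR m * f m = prefix f m - prefix f (m - n)).
  { intros [|m] Hm; [lia|]. rewrite Hf. field. apply not_0_INR. lia. }
  assert (Hn0 : 0 < INR n) by (apply lt_0_INR; lia).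
  set (th := INR n / (INR n + 1)).
  assert (Hth : 0 < th < 1).
  { unfold th. split; [apply Rdiv_lt_0_compat; lra|].
    apply Rmult_lt_reg_r with (INR n + 1); [lra|]. field_simplify; lra. }
  assert (Hpos : forall m, forall i, (i <= m)%nat -> 0 <= f i).
  { intros m; induction m as [|m IH]; intros i Hi.
    - replace i with O by lia. lra.
    - destruct (Nat.eq_dec i (S m)) as [->|]; [|apply IH; lia].
      rewrite Hf. apply Rle_div_r; [apply lt_0_INR; lia|]. rewrite Rmult_0_l.
      pose proof (prefix_window_lower f 0 (S m - n) (S m - (S m - n))) as H.
      replace (S m - n + (S m - (S m - n)))%nat with (S m) in H by lia.
      rewrite Rmult_0_r in H. apply H. intros; apply IH; lia. }
  assert (Hstep : forall m, f (S m) <= f m /\ ((n <= m)%nat -> f (S m) <= th * f m)).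
  { intros m; induction m as [m IH] using (well_founded_induction Wf_nat.lt_wf).
    assert (Hmono : forall i d, (i + d <= m)%nat -> f (i + d)%nat <= f i).
    { intros i d; induction d as [|d IHd]; intros H; [rewrite Nat.add_0_r; lra|].
      rewrite Nat.add_succ_r. destruct (IH (i + d)%nat ltac:(lia)) as [H1 _].
      specialize (IHd ltac:(lia)). lra. }
    assert (Hfm : 0 <= f m) by (apply (Hpos m); lia).
    assert (HS : 0 < INR (S m)) by (apply lt_0_INR; lia).
    destruct (Nat.le_gt_cases n m) as [Hnm|Hnm].
    - assert (Hd : INR (S m) * f (S m) = INR (S m) * f m - f (m - n)%nat).
      { rewrite Hrec by lia. replace (S m - n)%nat with (S (m - n)) by lia. simpl prefix.
        rewrite S_INR. pose proof (Hrec m ltac:(lia)). lra. }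
      assert (Hw : INR m * f m <= INR n * f (m - n)%nat).
      { rewrite Hrec by lia.
        pose proof (prefix_window_upper f (f (m - n)%nat) (m - n) n) as H.
        replace (m - n + n)%nat with m in H by lia. apply H.
        intros i Hi. replace i with (m - n + (i - (m - n)))%nat at 1 by lia.
        apply Hmono. lia. }
      assert (HR : INR n <= INR m) by (apply le_INR; exact Hnm).
      assert (H1 : f (S m) <= th * f m).
      { rewrite S_INR in *. apply Rmult_le_reg_l with ((INR m + 1) * (INR n + 1) * INR n).
        { apply Rmult_lt_0_compat; [apply Rmult_lt_0_compat; lra|lra]. }
        replace ((INR m + 1) * (INR n + 1) * INR n * (th * f m))
          with ((INR m + 1) * INR n * (INR n * f m)) by (unfold th; field; lra).
        replace ((INR m + 1) * (INR n + 1) * INR n * f (S m))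
          with ((INR n + 1) * INR n * ((INR m + 1) * f (S m))) by ring.
        rewrite Hd.
        (* reduces to (n + 1) f_(m-n) >= (m + 1) f_m, which follows from n f_(m-n) >= m f_m *)
        assert (INR n * (f m * (INR m + 1)) <= INR n * ((INR n + 1) * f (m - n)%nat)).
        { apply Rle_trans with ((INR n + 1) * (INR m * f m)); [nra|].
          replace (INR n * ((INR n + 1) * f (m - n)%nat))
            with ((INR n + 1) * (INR n * f (m - n)%nat)) by ring.
          apply Rmult_le_compat_l; lra. }
        nra. }
      split; [|intros _; exact H1]. nra.
    - split; [|lia]. destruct m as [|m].
      + pose proof (Hrec 1%nat ltac:(lia)) as H. replace (1 - n)%nat with O in H by lia.
        simpl in H. lra.
      + apply Rmult_le_reg_l with (INR (S (S m))); [exact HS|].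
        rewrite Hrec by lia. pose proof (Hrec (S m) ltac:(lia)) as H.
        replace (S (S m) - n)%nat with O by lia. replace (S m - n)%nat with O in H by lia.
        rewrite (S_INR (S m)). simpl prefix in *. lra. }
  assert (H1 : forall m, f m <= 1).
  { intros m; induction m as [|m IH]; [lra|]. destruct (Hstep m). lra. }
  exists f. split; [exact Hf0|]. split; [exact Hrec|]. split.
  - intros m. split; [apply (Hpos m); lia|apply H1].
  - intros j; induction j as [|j IH]; [rewrite Nat.add_0_r; simpl; apply H1|].
    rewrite Nat.add_succ_r. destruct (Hstep (n + j)%nat) as [_ H]. specialize (H ltac:(lia)).
    simpl. nra.
Qed.

(** Partial sums move by at most [c / (1 - q)] beyond degree [k] when the terms
    there are dominated by the geometric sequence [c q^j]. *)
Lemma csum_increment_geom (b : nat -> C) (c q : R) (k d : nat) :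
  0 <= c -> 0 <= q < 1 ->
  (forall j, Cmod (b (S k + j)%nat) <= c * q ^ j) ->
  Cmod (csum b (k + d) - csum b k)%C <= c / (1 - q).
Proof.
  intros Hc Hq Hb.
  assert (H : Cmod (csum b (k + d) - csum b k)%C <= c * (1 - q ^ d) / (1 - q)).
  { induction d as [|d IH].
    - rewrite Nat.add_0_r. replace (csum b k - csum b k)%C with (RtoC 0) by ring.
      rewrite Cmod_0. simpl. right. field. lra.
    - rewrite Nat.add_succ_r, csum_S.
      replace (csum b (k + d) + b (S (k + d)) - csum b k)%C
        with ((csum b (k + d) - csum b k) + b (S k + d)%nat)%C by (simpl; ring).
      eapply Rle_trans; [apply Cmod_triangle|].
      eapply Rle_trans; [apply Rplus_le_compat; [apply IH|apply Hb]|].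
      right. simpl. field. lra. }
  eapply Rle_trans; [exact H|].
  apply Rmult_le_compat_r; [left; apply Rinv_0_lt_compat; lra|].
  assert (0 <= q ^ d) by (apply pow_le; lra). nra.
Qed.

Lemma linear_times_pow_small (r delta : R) (n : nat) :
  0 < r < 1 -> 0 < delta -> exists M, (n <= M)%nat /\ INR (S M) * r ^ S M < delta.
Proof.
  intros Hr Hd. set (q := sqrt r).
  assert (Hq0 : 0 < q) by (apply sqrt_lt_R0; lra).
  assert (Hqq : q * q = r) by (apply sqrt_sqrt; lra).
  assert (Hq1 : q < 1) by nra.
  set (h := / q - 1).
  assert (Hh : 0 < h).
  { unfold h. assert (1 < / q); [|lra]. rewrite <- Rinv_1. apply Rinv_lt_contravar; lra. }
  destruct (pow_lt_1_zero q ltac:(rewrite Rabs_pos_eq; lra) (delta * h) ltac:(nra)) as [N HN].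
  exists (Nat.max n N). split; [lia|]. set (M := S (Nat.max n N)).
  specialize (HN M ltac:(lia)). rewrite Rabs_pos_eq in HN by (apply pow_le; lra).
  assert (Hb : INR M * h <= / q ^ M).
  { pose proof (poly M h Hh) as Hp. replace (1 + h) with (/ q) in Hp by (unfold h; ring).
    rewrite pow_inv in Hp. lra. }
  assert (HqM : 0 < q ^ M) by (apply pow_lt; lra).
  assert (Hb' : INR M * h * q ^ M <= 1).
  { apply Rmult_le_compat_r with (r := q ^ M) in Hb; [|lra].
    rewrite Rinv_l in Hb by lra. exact Hb. }
  rewrite <- Hqq, Rpow_mult_distr.
  apply Rmult_lt_reg_r with h; [exact Hh|]. nra.
Qed.

(** If [|s_m| <= r^m] for [1 <= m <= n] with [n r^(n+1) < (1 - r)(1 + n (1 - r))],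
    then no [mu k] equals 1.  With [e] and [e'] the power series of
    [exp (-+ sum_(i <= n) s_i X^i / i)], the product [e e'] is 1, [e] agrees with
    [prod_k (1 - mu k X)] up to degree [n], and both are dominated by
    [exp (sum_(i <= n) (r X)^i / i)].  If 1 were a root, the value of [e] at 1
    would come from its terms beyond degree [n] only, and the product of
    the values could not reach 1. *)
Lemma no_unit_root_geometric (mu : nat -> C) (n : nat) (r : R) :
  (1 <= n)%nat -> 0 < r < 1 ->
  INR n * r ^ (n + 1) < (1 - r) * (1 + INR n * (1 - r)) ->
  (forall m, (1 <= m <= n)%nat -> Cmod (power_sum mu n m) <= r ^ m) ->
  forall k, (1 <= k <= n)%nat -> mu k <> 1%C.
Proof.
  intros Hn Hr Hcond Hps k Hk H1.
  pose proof (lin_prod_root mu n k n Hk H1 (le_n n)) as Hroot.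
  set (s := fun i => if andb (Nat.leb 1 i) (Nat.leb i n) then power_sum mu n i else RtoC 0).
  assert (Hs0 : s O = 0%C) by reflexivity.
  destruct (exp_series_exists (-(1))%C s Hs0) as [e [He0 He]].
  destruct (exp_series_exists 1%C s Hs0) as [e' [He0' He']].
  destruct (exp_majorant n Hn) as [f [Hf0 [Hf [Hf1 Hfth]]]].
  set (th := INR n / (INR n + 1)) in *.
  assert (Hn0 : 0 < INR n) by (apply lt_0_INR; lia).
  assert (Hth : 0 < th < 1).
  { unfold th. split; [apply Rdiv_lt_0_compat; lra|].
    apply Rmult_lt_reg_r with (INR n + 1); [lra|]. field_simplify; lra. }
  (* both exponentials are dominated by f *)
  assert (Hdom : forall (c : C) (u : nat -> C), Cmod c = 1 -> u O = 1%C ->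
     (forall m, RtoC (INR m) * u m = c * conv s u m)%C ->
     forall m, Cmod (u m) <= f m * r ^ m).
  { intros c u Hc Hu0 Hu m.
    induction m as [m IH] using (well_founded_induction Wf_nat.lt_wf).
    destruct m as [|m]; [rewrite Hu0, Cmod_1, Hf0; simpl; lra|].
    assert (HSm : 0 < INR (S m)) by (apply lt_0_INR; lia).
    apply Rmult_le_reg_l with (INR (S m)); [exact HSm|].
    replace (INR (S m) * Cmod (u (S m))) with (Cmod (RtoC (INR (S m)) * u (S m))).
    2:{ rewrite Cmod_mult, Cmod_R, Rabs_pos_eq by lra. reflexivity. }
    rewrite Hu, Cmod_mult, Hc, Rmult_1_l, <- Rmult_assoc, Hf by lia.
    rewrite <- sum_window. eapply Rle_trans; [apply Cmod_conv_le|].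
    rewrite Rmult_comm, scal_sum. apply sum_Rle. intros i Hi. unfold s.
    destruct (Nat.leb_spec 1 i) as [Hi1|Hi1]; [destruct (Nat.leb_spec i n) as [Hin|Hin]|];
      simpl andb; cbv iota; try (rewrite Cmod_0; lra).
    specialize (Hps i ltac:(lia)). specialize (IH (S m - i)%nat ltac:(lia)).
    replace (f (S m - i)%nat * r ^ S m) with (r ^ i * (f (S m - i)%nat * r ^ (S m - i))).
    2:{ replace (r ^ S m) with (r ^ i * r ^ (S m - i))
          by (rewrite <- pow_add; f_equal; lia). ring. }
    apply Rmult_le_compat; try apply Cmod_ge_0; assumption. }
  assert (Hde : forall m, Cmod (e m) <= f m * r ^ m).
  { apply (Hdom (-(1))%C); [|exact He0|exact He]. rewrite Cmod_opp. apply Cmod_1. }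
  assert (Hde' : forall m, Cmod (e' m) <= f m * r ^ m).
  { apply (Hdom 1%C); [apply Cmod_1|exact He0'|exact He']. }
  assert (Hle : forall u : nat -> C, (forall m, Cmod (u m) <= f m * r ^ m) ->
     forall m, Cmod (u m) <= r ^ m).
  { intros u Hu m. specialize (Hu m). destruct (Hf1 m).
    assert (0 <= r ^ m) by (apply pow_le; lra). nra. }
  (* e e' = 1, since its Euler derivative vanishes *)
  assert (Hprod : forall m, conv e e' (S m) = 0%C).
  { intros m.
    assert (H : (RtoC (INR (S m)) * conv e e' (S m) = 0)%C).
    { rewrite conv_euler.
      rewrite (conv_ext _ (fun i => (-(1) * conv s e i)%C) e' e');
        [|intros; apply He|reflexivity].
      rewrite (conv_ext e e (fun i => (RtoC (INR i) * e' i)%C) (fun i => (1 * conv s e' i)%C));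
        [|reflexivity|intros; apply He'].
      rewrite conv_scal_l, conv_scal_r, <- (conv_assoc e s e').
      rewrite (conv_ext (conv e s) (conv s e) e' e');
        [|intros; apply conv_comm|reflexivity]. ring. }
    assert (HN : RtoC (INR (S m)) <> 0%C).
    { intros H'. apply RtoC_inj in H'. apply (not_0_INR (S m)); [lia|exact H']. }
    transitivity (/ RtoC (INR (S m)) * (RtoC (INR (S m)) * conv e e' (S m)))%C;
      [field; exact HN|rewrite H; ring]. }
  assert (Hone : forall M, csum (conv e e') M = 1%C).
  { induction M as [|M IH]; [rewrite csum_0; simpl; rewrite He0, He0'; ring|].
    rewrite csum_S, IH, Hprod. ring. }
  (* e agrees with the polynomial up to degree n *)
  assert (Hagree : forall m, (m <= n)%nat -> e m = lin_prod mu n m).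
  { intros m; induction m as [m IH] using (well_founded_induction Wf_nat.lt_wf). intros Hm.
    destruct m as [|m]; [rewrite He0, lin_prod_0; reflexivity|].
    assert (HN : RtoC (INR (S m)) <> 0%C).
    { intros H'. apply RtoC_inj in H'. apply (not_0_INR (S m)); [lia|exact H']. }
    assert (H : (RtoC (INR (S m)) * e (S m) = RtoC (INR (S m)) * lin_prod mu n (S m))%C).
    { rewrite He, newton_identities, !conv_S, Hs0. simpl (power_sum mu n 0).
      rewrite (conv_ext (fun i => s (S i)) (fun i => power_sum mu n (S i)) e (lin_prod mu n)).
      - ring.
      - intros i Hi. unfold s. destruct (Nat.leb_spec 1 (S i)); [|lia].
        destruct (Nat.leb_spec (S i) n); [reflexivity|lia].
      - intros i Hi. apply IH; lia. }
    transitivity (/ RtoC (INR (S m)) * (RtoC (INR (S m)) * e (S m)))%C;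
      [field; exact HN|rewrite H; field; exact HN]. }
  assert (Hen : csum e n = 0%C).
  { rewrite <- Hroot. apply csum_ext. exact Hagree. }
  (* estimate of the values of e and e' at 1 *)
  assert (Hthr : 0 <= th * r < 1) by nra.
  assert (Hrn : 0 < r ^ n) by (apply pow_lt; lra).
  set (T := r ^ n * (th * r) / (1 - th * r)).
  assert (HA : forall d, Cmod (csum e (n + d)) <= T).
  { intros d. replace (csum e (n + d)) with (csum e (n + d) - csum e n)%C
      by (rewrite Hen; ring).
    unfold T. apply csum_increment_geom; [nra|exact Hthr|]. intros j.
    eapply Rle_trans; [apply Hde|].
    replace (S n + j)%nat with (n + S j)%nat by lia.
    eapply Rle_trans;
      [apply Rmult_le_compat_r; [apply pow_le; lra|apply (Hfth (S j))]|].
    right. rewrite pow_add, Rpow_mult_distr. simpl. ring. }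
  assert (HB : forall M, Cmod (csum e' M) <= / (1 - r)).
  { intros M. replace (csum e' M) with ((csum e' (0 + M) - csum e' 0) + 1)%C
      by (rewrite csum_0, He0'; simpl; ring).
    eapply Rle_trans; [apply Cmod_triangle|]. rewrite Cmod_1.
    replace (/ (1 - r)) with (r / (1 - r) + 1) by (field; lra).
    apply Rplus_le_compat_r. apply csum_increment_geom; [lra|lra|].
    intros j. apply (Hle e' Hde' (S j)). }
  (* truncation error of the product *)
  assert (Herr : forall M, Cmod (csum e M * csum e' M - 1)%C
      <= INR (S M) * r ^ S M / (1 - r)).
  { intros M.
    assert (Hc : forall z N, csum (fun i => (e i * (z - csum e' (M - i)%nat))%C) N
       = (csum e N * z - csum (fun i => (e i * csum e' (M - i)%nat)%C) N)%C).
    { intros z N; induction N as [|N IH]; [rewrite !csum_0; ring|].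
      rewrite !csum_S, IH. ring. }
    rewrite <- (Hone M), sum_conv, conv_sum.
    change (sum_n (G := C_AbelianMonoid) ?u M) with (csum u M).
    rewrite <- Hc.
    eapply Rle_trans; [apply Cmod_csum_le|].
    replace (INR (S M) * r ^ S M / (1 - r))
      with (sum_f_R0 (fun _ => r ^ S M / (1 - r)) M)
      by (rewrite sum_cte; field; lra).
    apply sum_Rle. intros i Hi. rewrite Cmod_mult.
    assert (HBi : Cmod (csum e' M - csum e' (M - i))%C <= r ^ S (M - i) / (1 - r)).
    { replace (csum e' M) with (csum e' ((M - i) + i)) by (f_equal; lia).
      apply csum_increment_geom; [apply pow_le; lra|lra|].
      intros j. rewrite <- pow_add. apply (Hle e' Hde'). }
    replace (r ^ S M / (1 - r)) with (r ^ i * (r ^ S (M - i) / (1 - r))).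
    2:{ replace (r ^ S M) with (r ^ i * r ^ S (M - i))
          by (rewrite <- pow_add; f_equal; lia). field; lra. }
    apply Rmult_le_compat; try apply Cmod_ge_0; [apply (Hle e Hde)|exact HBi]. }
  assert (HD : 0 < 1 + INR n * (1 - r)) by nra.
  assert (Hkappa : T * / (1 - r) < 1).
  { assert (HT : T = INR n * r ^ (n + 1) / (1 + INR n * (1 - r))).
    { unfold T, th. rewrite pow_add. simpl. field. split; lra. }
    rewrite HT.
    apply Rmult_lt_reg_r with ((1 + INR n * (1 - r)) * (1 - r)); [nra|].
    replace (INR n * r ^ (n + 1) / (1 + INR n * (1 - r)) * / (1 - r)
      * ((1 + INR n * (1 - r)) * (1 - r))) with (INR n * r ^ (n + 1)) by (field; split; lra).
    lra. }
  destruct (linear_times_pow_small r ((1 - T * / (1 - r)) * (1 - r)) n Hr ltac:(nra))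
    as [M [HM Hsmall]].
  specialize (Herr M).
  assert (HAB : Cmod (csum e M * csum e' M)%C <= T * / (1 - r)).
  { rewrite Cmod_mult. apply Rmult_le_compat; try apply Cmod_ge_0; [|apply HB].
    replace M with (n + (M - n))%nat by lia. apply HA. }
  assert (H2 : 1 <= Cmod (csum e M * csum e' M)%C + Cmod (csum e M * csum e' M - 1)%C).
  { rewrite <- Cmod_1 at 1.
    replace (RtoC 1) with (csum e M * csum e' M + - (csum e M * csum e' M - 1))%C at 1 by ring.
    eapply Rle_trans; [apply Cmod_triangle|]. rewrite Cmod_opp. lra. }
  assert (H3 : INR (S M) * r ^ S M / (1 - r) < 1 - T * / (1 - r)).
  { apply Rmult_lt_reg_r with (1 - r); [lra|].
    replace (INR (S M) * r ^ S M / (1 - r) * (1 - r)) with (INR (S M) * r ^ S M)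
      by (field; lra). exact Hsmall. }
  lra.
Qed.

(** * Numerical estimates for the radius factor [1 + eps_ n] *)

(** The tangent to the logarithm at [exp c]. *)
Lemma ln_le_tangent (x c : R) : 0 < x -> ln x <= x * exp (- c) + c - 1.
Proof.
  intros Hx. pose proof (exp_ineq1_le (ln x - c)) as H.
  replace (ln x - c) with (ln x + - c) in H by ring. rewrite exp_plus, exp_ln in H by exact Hx. lra.
Qed.

Lemma exp_le_pade (t : R) : 0 <= t < 2 -> exp t <= (2 + t) / (2 - t).
Proof.
  intros Ht. apply Rle_div_r; [lra|].
  destruct (MVT_gen (fun x => 2 + x - exp x * (2 - x)) 0 t (fun x => 1 - exp x * (1 - x)))
    as [c [Hc H]].
  - intros x _. auto_derive; [exact I|]. ring.
  - intros x _. apply derivable_continuous_pt. apply ex_derive_Reals_0.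
    auto_derive. exact I.
  - rewrite exp_0 in H. rewrite Rmin_left, Rmax_right in Hc by lra.
    assert (exp c * (1 - c) <= 1).
    { pose proof (exp_ineq1_le (- c)) as H1. pose proof (exp_pos c) as H2.
      assert (H3 : exp c * exp (- c) = 1) by (rewrite <- exp_plus, Rplus_opp_r; apply exp_0).
      apply Rle_trans with (exp c * exp (- c)); [apply Rmult_le_compat_l; lra|lra]. }
    nra.
Qed.

Lemma exp_INR_mult (k : nat) (t : R) : exp (INR k * t) = exp t ^ k.
Proof.
  induction k as [|k IH]; [simpl; rewrite Rmult_0_l; apply exp_0|].
  rewrite S_INR, Rmult_plus_distr_r, exp_plus, IH. simpl. rewrite Rmult_1_l. ring.
Qed.

Lemma exp_le_pow (e : R) (k : nat) :
  0 <= e -> exp (INR k * (2 * e / (2 + e))) <= (1 + e) ^ k.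
Proof.
  intros He. rewrite exp_INR_mult. apply pow_incr.
  split; [left; apply exp_pos|].
  eapply Rle_trans; [apply exp_le_pade|].
  - split; [apply Rle_div_r; lra|]. apply Rmult_lt_reg_r with (2 + e); [lra|].
    field_simplify; lra.
  - right. field. lra.
Qed.

(** The constant [2 / 33] is the lower bound of [ln (17 / 16)] obtained from
    [exp_le_pade]. *)
Lemma ln_ge_of_pow (k : nat) (x : R) : (17 / 16) ^ k <= x -> INR k * (2 / 33) <= ln x.
Proof.
  intros H. rewrite <- (ln_exp (INR k * (2 / 33))). apply ln_le; [apply exp_pos|].
  eapply Rle_trans; [|exact H].
  pose proof (exp_le_pow (1 / 16) k ltac:(lra)) as H1.
  replace (2 * (1 / 16) / (2 + 1 / 16)) with (2 / 33) in H1 by field.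
  replace (1 + 1 / 16) with (17 / 16) in H1 by field. exact H1.
Qed.

Lemma exp_1_bounds : 2.7 <= exp 1 <= 2.721.
Proof.
  split.
  - eapply Rle_trans; [|apply (exp_ge_taylor 1 5); lra]. simpl. lra.
  - pose proof (exp_le_pow (1 / 16) 17 ltac:(lra)) as H.
    replace (INR 17 * (2 * (1 / 16) / (2 + 1 / 16))) with (1 + 1 / 33) in H
      by (simpl; field).
    rewrite exp_plus in H. pose proof (exp_ineq1_le (1 / 33)).
    pose proof (exp_pos 1). simpl in H. nra.
Qed.

Lemma exp_neg_le (c b : R) : 0 < b -> b <= exp c -> exp (- c) <= / b.
Proof. intros Hb H. rewrite exp_Ropp. apply Rinv_le_contravar; assumption. Qed.

(** Monotonicity in [e] of the quantity compared with [n] in [eps_condition]. *)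
Lemma condition_mono (n : nat) (e0 e : R) :
  0 <= e0 <= e ->
  INR n < e0 * (1 + (INR n + 1) * e0) * (1 + e0) ^ (n - 1) ->
  INR n < e * (1 + (INR n + 1) * e) * (1 + e) ^ (n - 1).
Proof.
  intros He H. pose proof (pos_INR n) as Hn.
  eapply Rlt_le_trans; [exact H|]. apply Rmult_le_compat.
  - apply Rmult_le_pos; [lra|nra].
  - apply pow_le; lra.
  - apply Rmult_le_compat; nra.
  - apply pow_incr; lra.
Qed.

Lemma ln_sub_lnln_ge_1 (y : R) : 0 < y -> 1 <= y - ln y.
Proof.
  intros Hy. pose proof (ln_le_tangent y 0 Hy) as H.
  rewrite Ropp_0, exp_0 in H. lra.
Qed.

Lemma ln_le_div_e (y : R) : 0 < y -> ln y <= y / 2.7.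
Proof.
  intros Hy. pose proof (ln_le_tangent y 1 Hy) as H.
  pose proof (exp_neg_le 1 2.7 ltac:(lra) (proj1 exp_1_bounds)). unfold Rdiv. nra.
Qed.

Lemma ln_INR_pos (n : nat) : (2 <= n)%nat -> 0 < ln (INR n).
Proof.
  intros Hn. rewrite <- ln_1. apply ln_increasing; [lra|].
  apply (lt_INR 1 n). lia.
Qed.

Lemma eps_condition_large (n : nat) :
  (16 <= n)%nat ->
  INR n < eps_ n * (1 + (INR n + 1) * eps_ n) * (1 + eps_ n) ^ (n - 1).
Proof.
  intros Hn.
  assert (Hn16 : 16 <= INR n) by (apply (le_INR 16) in Hn; simpl in Hn; lra).
  pose proof (ln_INR_pos n ltac:(lia)) as Hy.
  set (y := ln (INR n)) in *.
  assert (Hye : exp 1 <= y).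
  { eapply Rle_trans; [apply exp_1_bounds|].
    eapply Rle_trans; [|apply (ln_ge_of_pow 45)]; [simpl; lra|].
    apply Rle_trans with 16; [simpl; lra|exact Hn16]. }
  assert (Hlny : 1 <= ln y).
  { rewrite <- (ln_exp 1). apply ln_le; [apply exp_pos|exact Hye]. }
  set (s := sqrt (INR n)).
  assert (Hss : s * s = INR n) by (apply sqrt_sqrt; lra).
  assert (Hs0 : 0 <= s) by apply sqrt_pos.
  assert (Hs : 4 <= s) by nra.
  assert (Hys : y = 2 * ln s).
  { unfold y. rewrite <- Hss, ln_mult by lra. ring. }
  set (L := y - ln y).
  pose proof (ln_sub_lnln_ge_1 y Hy) as HL1. fold L in HL1.
  (* 0.4486 bounds 2 exp (-3/2), the slope of the tangent used for ln s *)
  assert (HLs : L <= 0.4486 * s).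
  { pose proof (ln_le_tangent s (3 / 2) ltac:(lra)) as H.
    assert (He : exp (- (3 / 2)) <= / 4.46).
    { apply exp_neg_le; [lra|]. eapply Rle_trans; [|apply (exp_ge_taylor (3 / 2) 5); lra].
      simpl. lra. }
    unfold L. assert (s * exp (- (3 / 2)) <= s * / 4.46) by nra. lra. }
  (* 0.6296 is slightly less than 1 - 1 / 2.7 *)
  assert (HLy : 0.6296 * y <= L).
  { unfold L. pose proof (ln_le_div_e y Hy). lra. }
  assert (Hsy : 1.35 * y <= s).
  { pose proof (ln_le_div_e s ltac:(lra)). lra. }
  assert (Heps : eps_ n = 2 * L / INR n) by reflexivity.
  assert (Heps0 : 0 < eps_ n) by (rewrite Heps; apply Rdiv_lt_0_compat; lra).
  (* l bounds the loss in replacing (1 + eps_ n)^(n - 1) by exp (n eps_ n) *)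
  set (l := 2 * L * (1 + L) / INR n).
  assert (Hpow : exp (2 * L) * exp (- l) <= (1 + eps_ n) ^ (n - 1)).
  { eapply Rle_trans; [|apply exp_le_pow; lra].
    rewrite <- exp_plus.
    assert (HH : 2 * L + - l <= INR (n - 1) * (2 * eps_ n / (2 + eps_ n))).
    { rewrite minus_INR by lia. rewrite Heps. unfold l. simpl (INR 1).
      replace ((INR n - 1) * (2 * (2 * L / INR n) / (2 + 2 * L / INR n)))
        with (2 * L - 2 * L * (1 + L) / (INR n + L)) by (field; lra).
      assert (2 * L * (1 + L) / (INR n + L) <= 2 * L * (1 + L) / INR n).
      { apply Rmult_le_compat_l; [nra|]. apply Rinv_le_contravar; lra. }
      lra. }
    destruct HH as [HH|HH]; [left; apply exp_increasing; exact HH|rewrite HH; lra]. }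
  assert (HexpL : exp (2 * L) = (INR n / y) ^ 2).
  { unfold L. replace (2 * (y - ln y)) with ((y + - ln y) + (y + - ln y)) by ring.
    rewrite !exp_plus, exp_Ropp, exp_ln by exact Hy. unfold y at 1 3.
    rewrite exp_ln by lra. unfold Rdiv. ring. }
  (* exp l is at most 1.504 + 1.1265 / y *)
  assert (Hl : exp l * y <= 1.504 * y + 1.1265).
  { set (t := 0.8972 / s).
    assert (Ht : t * s = 0.8972) by (unfold t; field; lra).
    assert (Ht0 : 0 < t) by (unfold t; apply Rdiv_lt_0_compat; lra).
    assert (Ht1 : t <= 0.2243) by nra.
    assert (Hlt : l <= 0.4025 + t).
    { unfold l. apply Rmult_le_reg_r with (INR n); [lra|].
      replace (2 * L * (1 + L) / INR n * INR n) with (2 * L * (1 + L)) by (field; lra).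
      rewrite <- Hss. replace ((0.4025 + t) * (s * s)) with (0.4025 * (s * s) + 0.8972 * s)
        by (rewrite <- Ht; ring). nra. }
    assert (Hel : exp l <= exp 0.4025 * exp t).
    { rewrite <- exp_plus. destruct Hlt as [H|H]; [left; apply exp_increasing; exact H|].
      rewrite H; lra. }
    assert (He1 : exp 0.4025 <= 1.504).
    { eapply Rle_trans; [apply exp_le_pade; lra|]. lra. }
    assert (He2 : exp t <= 1 + 1.127 * t).
    { eapply Rle_trans; [apply exp_le_pade; lra|].
      apply Rmult_le_reg_r with (2 - t); [lra|].
      replace ((2 + t) / (2 - t) * (2 - t)) with (2 + t) by (field; lra). nra. }
    assert (Hty : t * y <= 0.6646) by nra.
    pose proof (exp_pos t). pose proof (exp_pos 0.4025).
    apply Rle_trans with (1.504 * (1 + 1.127 * t) * y); [|nra].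
    apply Rmult_le_compat_r; [lra|].
    eapply Rle_trans; [exact Hel|]. apply Rmult_le_compat; lra. }
  assert (Hmain : exp l * y ^ 2 < 2 * L * (1 + 2 * L)).
  { apply Rle_lt_trans with (y * (1.504 * y + 1.1265)); [nra|].
    apply Rlt_le_trans with (2 * (0.6296 * y) * (1 + 2 * (0.6296 * y))); [nra|].
    apply Rmult_le_compat; nra. }
  assert (Hfin : INR n < eps_ n * (1 + INR n * eps_ n) * (exp (2 * L) * exp (- l))).
  { rewrite HexpL, Heps, exp_Ropp.
    replace (2 * L / INR n * (1 + INR n * (2 * L / INR n)) * ((INR n / y) ^ 2 * / exp l))
      with (INR n * (2 * L * (1 + 2 * L) / (exp l * y ^ 2))).
    2:{ field. pose proof (exp_pos l). repeat split; lra. }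
    rewrite <- (Rmult_1_r (INR n)) at 1. apply Rmult_lt_compat_l; [lra|].
    assert (0 < exp l * y ^ 2) by (apply Rmult_lt_0_compat; [apply exp_pos|nra]).
    apply Rmult_lt_reg_r with (exp l * y ^ 2); [assumption|].
    replace (2 * L * (1 + 2 * L) / (exp l * y ^ 2) * (exp l * y ^ 2))
      with (2 * L * (1 + 2 * L)) by (field; pose proof (exp_pos l); lra).
    lra. }
  eapply Rlt_le_trans; [exact Hfin|].
  apply Rmult_le_compat; [nra| |nra|exact Hpow].
  apply Rmult_le_pos; left; apply exp_pos.
Qed.

Lemma eps_ge (n : nat) : (2 <= n)%nat -> 2 / INR n <= eps_ n.
Proof.
  intros Hn. pose proof (ln_sub_lnln_ge_1 _ (ln_INR_pos n Hn)) as H.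
  assert (0 < INR n) by (apply lt_0_INR; lia).
  unfold eps_. apply Rmult_le_compat_r; [left; apply Rinv_0_lt_compat; assumption|]. lra.
Qed.

(** A lower bound for [eps_ n] from a rational lower bound for [ln n]; the
    factor [17 / 27 = 1 - 1 / 2.7] comes from [ln y <= y / 2.7]. *)
Lemma eps_ge_of_pow (n k : nat) :
  (2 <= n)%nat -> (17 / 16) ^ k <= INR n ->
  2 * (17 / 27 * (INR k * (2 / 33))) / INR n <= eps_ n.
Proof.
  intros Hn H. apply ln_ge_of_pow in H.
  pose proof (ln_INR_pos n Hn) as Hy. pose proof (ln_le_div_e _ Hy) as Hl.
  assert (0 < INR n) by (apply lt_0_INR; lia).
  unfold eps_. apply Rmult_le_compat_r; [left; apply Rinv_0_lt_compat; assumption|]. lra.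
Qed.

(** With [r = / (1 + eps_ n)] this is the hypothesis of
    [no_unit_root_geometric]. *)
Lemma eps_condition (n : nat) :
  (2 <= n)%nat ->
  INR n < eps_ n * (1 + (INR n + 1) * eps_ n) * (1 + eps_ n) ^ (n - 1).
Proof.
  intros Hn. destruct (Nat.le_gt_cases 16 n) as [H|H]; [apply eps_condition_large; exact H|].
  assert (Hsmall : forall k, (17 / 16) ^ k <= INR n ->
    INR n < 2 * (17 / 27 * (INR k * (2 / 33))) / INR n *
      (1 + (INR n + 1) * (2 * (17 / 27 * (INR k * (2 / 33))) / INR n)) *
      (1 + 2 * (17 / 27 * (INR k * (2 / 33))) / INR n) ^ (n - 1) ->
    INR n < eps_ n * (1 + (INR n + 1) * eps_ n) * (1 + eps_ n) ^ (n - 1)).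
  { intros k Hk. apply condition_mono. split; [|apply eps_ge_of_pow; assumption].
    pose proof (pos_INR k). assert (0 < INR n) by (apply lt_0_INR; lia).
    apply Rle_div_r; lra. }
  (* for n <= 5 the bound eps_ n >= 2 / n suffices; for 6 <= n <= 15 the exponent k
     is the largest with (17 / 16)^k <= n *)
  destruct (Nat.le_gt_cases n 5) as [H5|H5].
  - apply condition_mono with (2 / INR n).
    + split; [|apply eps_ge; exact Hn].
      apply Rle_div_r; [apply lt_0_INR; lia|lra].
    + do 2 (destruct n as [|n]; [lia|]).
      do 4 (destruct n as [|n]; [simpl; lra|]). lia.
  - do 6 (destruct n as [|n]; [lia|]).
    destruct n as [|n]; [apply (Hsmall 29%nat); simpl; lra|].
    destruct n as [|n]; [apply (Hsmall 32%nat); simpl; lra|].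
    destruct n as [|n]; [apply (Hsmall 34%nat); simpl; lra|].
    destruct n as [|n]; [apply (Hsmall 36%nat); simpl; lra|].
    destruct n as [|n]; [apply (Hsmall 37%nat); simpl; lra|].
    destruct n as [|n]; [apply (Hsmall 39%nat); simpl; lra|].
    destruct n as [|n]; [apply (Hsmall 40%nat); simpl; lra|].
    destruct n as [|n]; [apply (Hsmall 42%nat); simpl; lra|].
    destruct n as [|n]; [apply (Hsmall 43%nat); simpl; lra|].
    destruct n as [|n]; [apply (Hsmall 44%nat); simpl; lra|]. lia.
Qed.

(** The source of the factor [2 n^2] in the remainder estimate of part (a). *)
Lemma eps_power_upper (n : nat) :
  (3 <= n)%nat -> (1 + eps_ n) ^ (n + 1) + / INR n <= 2 * INR n ^ 2.
Proof.
  intros Hn.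
  assert (Hn3 : 3 <= INR n) by (apply (le_INR 3) in Hn; simpl in Hn; lra).
  pose proof (eps_ge n ltac:(lia)) as Hg.
  assert (0 < 2 / INR n) by (apply Rdiv_lt_0_compat; lra).
  pose proof (ln_INR_pos n ltac:(lia)) as Hy.
  pose proof (ln_le_div_e (INR n) ltac:(lra)) as Hyn.
  assert (Hy1 : 1 <= ln (INR n)).
  { rewrite <- (ln_exp 1). apply ln_le; [apply exp_pos|]. pose proof exp_1_bounds. lra. }
  assert (Heps : eps_ n = 2 * (ln (INR n) - ln (ln (INR n))) / INR n) by reflexivity.
  set (y := ln (INR n)) in *.
  assert (Hlny : 0 <= ln y) by (rewrite <- ln_1; apply ln_le; lra).
  assert (He : eps_ n <= 0.741).
  { rewrite Heps. apply Rmult_le_reg_r with (INR n); [lra|].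
    replace (2 * (y - ln y) / INR n * INR n) with (2 * (y - ln y)) by (field; lra). lra. }
  assert (Hp : (1 + eps_ n) ^ n <= INR n ^ 2).
  { apply Rle_trans with (exp (eps_ n) ^ n).
    - apply pow_incr. split; [lra|apply exp_ineq1_le].
    - rewrite <- exp_INR_mult, Heps.
      replace (INR n * (2 * (y - ln y) / INR n)) with (y + y + (- ln y + - ln y))
        by (field; lra).
      rewrite !exp_plus, exp_Ropp, exp_ln by exact Hy. unfold y at 1 2.
      rewrite exp_ln by lra.
      assert (/ y <= 1) by (rewrite <- Rinv_1; apply Rinv_le_contravar; lra).
      assert (0 < / y) by (apply Rinv_0_lt_compat; lra).
      assert (/ y * / y <= 1) by nra. nra. }
  rewrite Nat.add_1_r. simpl pow at 1.
  assert (/ INR n <= / 3) by (apply Rinv_le_contravar; lra).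
  assert (0 <= (1 + eps_ n) ^ n) by (apply pow_le; lra).
  assert ((1 + eps_ n) * (1 + eps_ n) ^ n <= 1.741 * INR n ^ 2)
    by (apply Rmult_le_compat; lra).
  nra.
Qed.

(** * Convergent complex series *)

(** The series with terms [a] has sum [l]. *)
Definition csums_to (a : nat -> C) (l : C) : Prop :=
  forall eps, 0 < eps -> exists N, forall n, (N <= n)%nat -> Cmod (csum a n - l)%C < eps.

Lemma csums_to_is_series (a : nat -> C) (l : C) :
  csums_to a l <-> is_series (K := C_AbsRing) (V := C_NormedModule) a l.
Proof.
  split.
  - intros H. apply (filterlim_locally_ball_norm (U := C_NormedModule)).
    intros eps. destruct (H eps (cond_pos eps)) as [N HN]. exists N. exact HN.
  - intros H eps He.
    destruct (proj1 (filterlim_locally_ball_norm (U := C_NormedModule) _ _) H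
      (mkposreal eps He)) as [N HN].
    exists N. exact HN.
Qed.

Lemma csums_to_ext (a b : nat -> C) (l : C) :
  (forall m, a m = b m) -> csums_to a l -> csums_to b l.
Proof.
  intros H Ha eps He. destruct (Ha eps He) as [N HN]. exists N. intros n Hn.
  rewrite <- (csum_ext a b n); [apply HN; exact Hn|intros; apply H].
Qed.

Lemma csums_to_is_pseries (a : nat -> C) (z l : C) :
  csums_to (fun m => (a m * z ^ m)%C) l
  <-> is_pseries (K := C_AbsRing) (V := C_NormedModule) a z l.
Proof.
  assert (H : forall k, (a k * z ^ k)%C
    = scal (V := C_NormedModule) (pow_n (K := C_AbsRing) z k) (a k)).
  { intros k. rewrite Cmult_comm. reflexivity. }
  unfold is_pseries. rewrite <- csums_to_is_series.
  split; apply csums_to_ext; intros m; (apply H || (symmetry; apply H)).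
Qed.

Lemma csums_to_plus (a b : nat -> C) (l l' : C) :
  csums_to a l -> csums_to b l' -> csums_to (fun m => (a m + b m)%C) (l + l')%C.
Proof.
  intros Ha Hb eps He.
  destruct (Ha (eps / 2) ltac:(lra)) as [N HN].
  destruct (Hb (eps / 2) ltac:(lra)) as [N' HN'].
  exists (Nat.max N N'). intros n Hn.
  assert (Hs : csum (fun m => (a m + b m)%C) n = (csum a n + csum b n)%C).
  { clear. induction n as [|n IH]; [rewrite !csum_0; reflexivity|].
    rewrite !csum_S, IH. ring. }
  rewrite Hs. replace (csum a n + csum b n - (l + l'))%C
    with ((csum a n - l) + (csum b n - l'))%C by ring.
  eapply Rle_lt_trans; [apply Cmod_triangle|].
  specialize (HN n ltac:(lia)). specialize (HN' n ltac:(lia)). lra.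
Qed.

Lemma csums_to_scal (c : C) (a : nat -> C) (l : C) :
  csums_to a l -> csums_to (fun m => (c * a m)%C) (c * l)%C.
Proof.
  intros Ha eps He. pose proof (Cmod_ge_0 c) as Hc.
  destruct (Ha (eps / (Cmod c + 1))) as [N HN]; [apply Rdiv_lt_0_compat; lra|].
  exists N. intros n Hn. specialize (HN n Hn).
  assert (Hs : csum (fun m => (c * a m)%C) n = (c * csum a n)%C).
  { clear. induction n as [|n IH]; [rewrite !csum_0; reflexivity|].
    rewrite !csum_S, IH. ring. }
  rewrite Hs. replace (c * csum a n - c * l)%C with (c * (csum a n - l))%C by ring.
  rewrite Cmod_mult.
  apply Rle_lt_trans with (Cmod c * (eps / (Cmod c + 1))).
  - apply Rmult_le_compat_l; lra.
  - apply Rmult_lt_reg_r with (Cmod c + 1); [lra|].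
    replace (Cmod c * (eps / (Cmod c + 1)) * (Cmod c + 1)) with (Cmod c * eps)
      by (field; lra). nra.
Qed.

Lemma csums_to_minus (a b : nat -> C) (l l' : C) :
  csums_to a l -> csums_to b l' -> csums_to (fun m => (a m - b m)%C) (l - l')%C.
Proof.
  intros Ha Hb. replace (l - l')%C with (l + -(1) * l')%C by ring.
  apply csums_to_ext with (fun m => (a m + -(1) * b m)%C); [intros; ring|].
  apply csums_to_plus; [exact Ha|]. apply csums_to_scal; exact Hb.
Qed.

Lemma csums_to_zero_from (a : nat -> C) :
  (forall m, a (S m) = 0%C) -> csums_to a (a O).
Proof.
  intros Ha eps He. exists O. intros n _.
  replace (csum a n) with (a O).
  - replace (a O - a O)%C with (RtoC 0) by ring. rewrite Cmod_0. exact He.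
  - induction n as [|n IH]; [rewrite csum_0; reflexivity|].
    rewrite csum_S, Ha, <- IH. ring.
Qed.

Lemma csums_to_geom_ex (a : nat -> C) (K q : R) :
  0 <= q < 1 -> (forall m, Cmod (a m) <= K * q ^ m) -> exists l, csums_to a l.
Proof.
  intros Hq Ha.
  destruct (ex_series_le (K := C_AbsRing) (V := C_CompleteNormedModule) a
    (fun m => K * q ^ m)) as [l Hl].
  - exact Ha.
  - apply (ex_series_scal (V := R_NormedModule) K (fun m => q ^ m)).
    apply ex_series_geom. rewrite Rabs_pos_eq; lra.
  - exists l. apply csums_to_is_series. exact Hl.
Qed.

Lemma csums_to_Cmod_le (a : nat -> C) (l : C) (M : R) :
  (forall n, Cmod (csum a n) <= M) -> csums_to a l -> Cmod l <= M.
Proof.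
  intros HM Ha. apply Rnot_lt_le. intros H.
  destruct (Ha (Cmod l - M) ltac:(lra)) as [N HN]. specialize (HN N (le_n N)).
  specialize (HM N).
  assert (Cmod l <= Cmod (csum a N) + Cmod (csum a N - l)%C).
  { replace l with (csum a N + - (csum a N - l))%C at 1 by ring.
    eapply Rle_trans; [apply Cmod_triangle|]. rewrite Cmod_opp. lra. }
  lra.
Qed.

(** A series with no terms up to degree [n] and a geometric majorant beyond. *)
Lemma csums_to_tail_le (a : nat -> C) (l : C) (K q : R) (n : nat) :
  0 <= K -> 0 <= q < 1 ->
  (forall m, (m <= n)%nat -> a m = 0%C) ->
  (forall m, (n < m)%nat -> Cmod (a m) <= K * q ^ m) ->
  csums_to a l -> Cmod l <= K * q ^ (n + 1) / (1 - q).
Proof.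
  intros HK Hq H0 Ha. apply csums_to_Cmod_le. intros N.
  assert (Hz : forall m, (m <= n)%nat -> csum a m = 0%C).
  { intros m; induction m as [|m IH]; intros Hm; [rewrite csum_0; apply H0; lia|].
    rewrite csum_S, IH, H0 by lia. ring. }
  assert (Hb : 0 <= K * q ^ (n + 1)) by (apply Rmult_le_pos; [lra|apply pow_le; lra]).
  destruct (Nat.le_gt_cases N n) as [HN|HN].
  - rewrite Hz, Cmod_0 by exact HN. apply Rle_div_r; lra.
  - replace (csum a N) with (csum a (n + (N - n)) - csum a n)%C.
    2:{ rewrite (Hz n) by lia. replace (n + (N - n))%nat with N by lia. ring. }
    apply csum_increment_geom; [exact Hb|exact Hq|]. intros j.
    eapply Rle_trans; [apply Ha; lia|]. right.
    replace (S n + j)%nat with (n + 1 + j)%nat by lia. rewrite pow_add. ring.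
Qed.

(** * Analyticity of the sum of a power series *)

(** Coefficients of [(w + X)^m]. *)
Fixpoint shift_pow (w : C) (m : nat) : nat -> C :=
  match m with
  | O => fun j => match j with O => 1%C | S _ => 0%C end
  | S p => fun j =>
      match j with
      | O => (w * shift_pow w p O)%C
      | S i => (w * shift_pow w p j + shift_pow w p i)%C
      end
  end.

Lemma shift_pow_sum (w d : C) (m J : nat) :
  (m <= J)%nat -> csum (fun j => (shift_pow w m j * d ^ j)%C) J = ((w + d) ^ m)%C.
Proof.
  revert J; induction m as [|m IH]; intros J HJ.
  - clear HJ. induction J as [|J IHJ]; [rewrite csum_0; simpl; ring|].
    rewrite csum_S, IHJ. simpl. ring.
  - destruct J as [|J]; [lia|].
    assert (H : forall N, csum (fun j => (shift_pow w (S m) j * d ^ j)%C) (S N)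
      = (w * csum (fun j => (shift_pow w m j * d ^ j)%C) (S N)
         + d * csum (fun j => (shift_pow w m j * d ^ j)%C) N)%C).
    { induction N as [|N IHN].
      - rewrite !csum_S, !csum_0. simpl. ring.
      - rewrite csum_S, IHN, (csum_S _ (S N)), (csum_S _ N). simpl. ring. }
    rewrite H, (IH (S J)), (IH J) by lia. simpl. ring.
Qed.

Lemma shift_pow_abs_sum (w : C) (t : R) (m J : nat) :
  0 <= t -> sum_f_R0 (fun j => Cmod (shift_pow w m j) * t ^ j) J <= (Cmod w + t) ^ m.
Proof.
  intros Ht. pose proof (Cmod_ge_0 w) as Hw.
  revert J; induction m as [|m IH]; intros J.
  - induction J as [|J IHJ]; [simpl; rewrite Cmod_1; lra|].
    rewrite tech5. change (shift_pow w 0 (S J)) with (RtoC 0). rewrite Cmod_0. lra.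
  - assert (H : forall N, sum_f_R0 (fun j => Cmod (shift_pow w (S m) j) * t ^ j) (S N)
      <= Cmod w * sum_f_R0 (fun j => Cmod (shift_pow w m j) * t ^ j) (S N)
         + t * sum_f_R0 (fun j => Cmod (shift_pow w m j) * t ^ j) N).
    { assert (Hstep : forall j, Cmod (shift_pow w (S m) (S j)) * t ^ S j
        <= Cmod w * (Cmod (shift_pow w m (S j)) * t ^ S j)
           + t * (Cmod (shift_pow w m j) * t ^ j)).
      { intros j. simpl shift_pow.
        apply Rle_trans with ((Cmod w * Cmod (shift_pow w m (S j))
          + Cmod (shift_pow w m j)) * t ^ S j); [|simpl; right; ring].
        apply Rmult_le_compat_r; [apply pow_le; lra|].
        rewrite <- Cmod_mult. apply Cmod_triangle. }
      assert (H0 : Cmod (shift_pow w (S m) 0) * t ^ 0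
        = Cmod w * (Cmod (shift_pow w m 0) * t ^ 0)).
      { simpl shift_pow. rewrite Cmod_mult. ring. }
      revert Hstep H0.
      set (u := fun j => Cmod (shift_pow w (S m) j) * t ^ j).
      set (v := fun j => Cmod (shift_pow w m j) * t ^ j).
      change ((forall j, u (S j) <= Cmod w * v (S j) + t * v j) -> u O = Cmod w * v O ->
        forall N, sum_f_R0 u (S N) <= Cmod w * sum_f_R0 v (S N) + t * sum_f_R0 v N).
      clearbody u v. intros Hstep H0.
      induction N as [|N IHN].
      - specialize (Hstep O). rewrite !tech5. simpl sum_f_R0. lra.
      - specialize (Hstep (S N)). rewrite (tech5 u (S N)), (tech5 v (S N)), (tech5 v N).
        rewrite (tech5 v N) in IHN. lra. }
    assert (HS : sum_f_R0 (fun j => Cmod (shift_pow w (S m) j) * t ^ j) (S J)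
       <= (Cmod w + t) ^ S m).
    { eapply Rle_trans; [apply H|]. simpl pow. rewrite Rmult_plus_distr_r.
      apply Rplus_le_compat; apply Rmult_le_compat_l; auto. }
    eapply Rle_trans; [|exact HS]. apply (sum_f_R0_mono _ J (S J)); [|lia].
    intros j. apply Rmult_le_pos; [apply Cmod_ge_0|apply pow_le; lra].
Qed.

(** A function that is the sum of a power series on [B |z| < 1] with
    coefficients [O(B^m)] is analytic there: the series is re-expanded at [w],
    the truncations of the two expansions differing by a geometric tail. *)
Lemma analytic_at_of_pseries (g : nat -> C) (G : C -> C) (K B : R) (w : C) :
  0 <= K -> 0 <= B -> (forall m, Cmod (g m) <= K * B ^ m) ->
  (forall z, B * Cmod z < 1 -> csums_to (fun m => (g m * z ^ m)%C) (G z)) ->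
  B * Cmod w < 1 -> analytic_at G w.
Proof.
  intros HK HB Hg HG Hw. pose proof (Cmod_ge_0 w) as Hw0.
  set (t := (1 - B * Cmod w) / (2 * (B + 1))).
  assert (Htp : 0 < t) by (apply Rdiv_lt_0_compat; lra).
  assert (Ht2 : t * (2 * (B + 1)) = 1 - B * Cmod w) by (unfold t; field; lra).
  set (q := B * (Cmod w + t)).
  assert (Hq : 0 <= q < 1) by (unfold q; split; [apply Rmult_le_pos; lra|nra]).
  assert (Hqm : forall m, B ^ m * (Cmod w + t) ^ m = q ^ m)
    by (intros; unfold q; rewrite Rpow_mult_distr; reflexivity).
  assert (Hc : forall j, exists c, csums_to (fun m => (g m * shift_pow w m j)%C) c).
  { intros j. apply csums_to_geom_ex with (K / t ^ j) q; [exact Hq|]. intros m.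
    assert (Htj : 0 < t ^ j) by (apply pow_lt; exact Htp).
    rewrite Cmod_mult.
    apply Rmult_le_reg_r with (t ^ j); [exact Htj|].
    replace (K / t ^ j * q ^ m * t ^ j) with (K * q ^ m) by (field; lra).
    rewrite <- Hqm, (Rmult_assoc (Cmod (g m))), <- (Rmult_assoc K).
    apply Rmult_le_compat; [apply Cmod_ge_0| |apply Hg|].
    - apply Rmult_le_pos; [apply Cmod_ge_0|lra].
    - eapply Rle_trans; [|apply (shift_pow_abs_sum w t m j); lra].
      destruct j as [|j]; [simpl; lra|]. rewrite tech5.
      assert (0 <= sum_f_R0 (fun j => Cmod (shift_pow w m j) * t ^ j) j); [|lra].
      apply sum_nonneg. intros i. apply Rmult_le_pos; [apply Cmod_ge_0|apply pow_le; lra]. }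
  destruct (functional_choice _ Hc) as [c Hcs].
  exists c, t. split; [exact Htp|]. intros z Hz.
  set (d := (z - w)%C) in *.
  assert (Hzd : z = (w + d)%C) by (unfold d; ring).
  assert (HBz : B * Cmod z < 1).
  { eapply Rle_lt_trans; [|apply Hq]. apply Rmult_le_compat_l; [exact HB|].
    rewrite Hzd. eapply Rle_trans; [apply Cmod_triangle|lra]. }
  apply csums_to_is_pseries.
  assert (Htrunc : forall J, csums_to
     (fun m => (g m * csum (fun j => (shift_pow w m j * d ^ j)%C) J)%C)
     (csum (fun j => (c j * d ^ j)%C) J)).
  { induction J as [|J IHJ].
    - rewrite csum_0. rewrite Cmult_comm.
      eapply csums_to_ext; [|apply csums_to_scal, Hcs].
      intros m. simpl. rewrite csum_0. ring.
    - rewrite csum_S.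
      eapply csums_to_ext; [|apply csums_to_plus; [apply IHJ|]].
      2:{ rewrite Cmult_comm. apply csums_to_scal, Hcs. }
      intros m. simpl. rewrite csum_S. simpl. ring. }
  assert (Hest : forall J, Cmod (csum (fun j => (c j * d ^ j)%C) J - G z)%C
      <= 2 * K * q ^ (J + 1) / (1 - q)).
  { intros J. pose proof (csums_to_minus _ _ _ _ (Htrunc J) (HG z HBz)) as H.
    revert H. apply csums_to_tail_le; [lra|exact Hq| |].
    - intros m Hm. rewrite shift_pow_sum by exact Hm. rewrite Hzd. ring.
    - intros m Hm.
      replace (g m * csum (fun j => shift_pow w m j * d ^ j) J - g m * z ^ m)%C
        with (g m * (csum (fun j => shift_pow w m j * d ^ j) J + - z ^ m))%C by ring.
      rewrite Cmod_mult, <- Hqm.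
      replace (2 * K * (B ^ m * (Cmod w + t) ^ m))
        with (K * B ^ m * (2 * (Cmod w + t) ^ m)) by ring.
      apply Rmult_le_compat; [apply Cmod_ge_0|apply Cmod_ge_0|apply Hg|].
      eapply Rle_trans; [apply Cmod_triangle|]. rewrite Cmod_opp, Cmod_pow.
      assert (H1 : Cmod z ^ m <= (Cmod w + t) ^ m).
      { apply pow_incr. split; [apply Cmod_ge_0|].
        rewrite Hzd. eapply Rle_trans; [apply Cmod_triangle|lra]. }
      assert (H2 : Cmod (csum (fun j => (shift_pow w m j * d ^ j)%C) J)
        <= (Cmod w + t) ^ m).
      { eapply Rle_trans; [apply Cmod_csum_le|].
        eapply Rle_trans; [|apply (shift_pow_abs_sum w t m J); lra].
        apply sum_Rle. intros j _. rewrite Cmod_mult, Cmod_pow.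
        apply Rmult_le_compat_l; [apply Cmod_ge_0|].
        apply pow_incr. split; [apply Cmod_ge_0|lra]. }
      lra. }
  intros eps He.
  destruct (pow_lt_1_zero q ltac:(rewrite Rabs_pos_eq; lra)
     (eps * (1 - q) / (2 * K + 1))) as [N HN].
  { apply Rdiv_lt_0_compat; [apply Rmult_lt_0_compat; lra|lra]. }
  exists N. intros J HJ. eapply Rle_lt_trans; [apply Hest|].
  specialize (HN (J + 1)%nat ltac:(lia)).
  assert (Hqp : 0 <= q ^ (J + 1)) by (apply pow_le; lra).
  rewrite Rabs_pos_eq in HN by exact Hqp.
  apply Rmult_lt_compat_r with (r := 2 * K + 1) in HN; [|lra].
  replace (eps * (1 - q) / (2 * K + 1) * (2 * K + 1)) with (eps * (1 - q)) in HN
    by (field; lra).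
  apply Rmult_lt_reg_r with (1 - q); [lra|].
  replace (2 * K * q ^ (J + 1) / (1 - q) * (1 - q)) with (2 * K * q ^ (J + 1))
    by (field; lra). nra.
Qed.

(** * Location of the parameters [lam k] *)

Lemma power_sum_scal (c : C) (lam : nat -> C) (n m : nat) :
  power_sum (fun j => (c * lam j)%C) n m = (c ^ m * power_sum lam n m)%C.
Proof.
  destruct m as [|m]; [simpl; ring|].
  induction n as [|n IH].
  - unfold power_sum. rewrite !sum_1_0. ring.
  - rewrite !power_sum_S, IH, Cpow_mult_l. ring.
Qed.

(** Dividing by [lam k] reduces a bound on [|lam k|] to showing that no
    [c lam k] with [|c| B < 1] equals 1. *)
Lemma Cmod_le_of_no_unit_root (lam : nat -> C) (k : nat) (B : R) :
  0 <= B ->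
  (forall c : C, 0 < Cmod c -> Cmod c * B < 1 -> (c * lam k)%C <> 1%C) ->
  Cmod (lam k) <= B.
Proof.
  intros HB H. apply Rnot_lt_le. intros Hlt.
  assert (Hne : lam k <> 0%C) by (apply Cmod_gt_0; lra).
  apply (H (/ lam k)%C).
  - rewrite Cmod_inv by exact Hne. apply Rinv_0_lt_compat. lra.
  - rewrite Cmod_inv by exact Hne.
    apply Rmult_lt_reg_l with (Cmod (lam k)); [lra|].
    rewrite <- Rmult_assoc, Rinv_r by lra. lra.
  - field. exact Hne.
Qed.

Lemma Cmod_le_of_power_sums_geometric (lam : nat -> C) (n : nat) (r a : R) :
  (1 <= n)%nat -> 0 < r < 1 -> 0 <= a ->
  INR n * r ^ (n + 1) < (1 - r) * (1 + INR n * (1 - r)) ->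
  (forall m, (1 <= m <= n)%nat -> Cmod (power_sum lam n m) <= a ^ m) ->
  forall k, (1 <= k <= n)%nat -> Cmod (lam k) <= / r * a.
Proof.
  intros Hn Hr Ha Hcond Hps k Hk.
  apply (Cmod_le_of_no_unit_root lam).
  { apply Rmult_le_pos; [left; apply Rinv_0_lt_compat; lra|exact Ha]. }
  intros c Hc HcB.
  apply (no_unit_root_geometric (fun j => (c * lam j)%C) n r Hn Hr Hcond); [|exact Hk].
  intros m Hm. rewrite power_sum_scal, Cmod_mult, Cmod_pow.
  apply Rle_trans with ((Cmod c * a) ^ m).
  - rewrite Rpow_mult_distr. apply Rmult_le_compat_l; [apply pow_le; lra|apply Hps, Hm].
  - apply pow_incr. split; [apply Rmult_le_pos; lra|].
    apply Rmult_lt_compat_r with (r := r) in HcB; [|lra].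
    replace (Cmod c * (/ r * a) * r) with (Cmod c * a) in HcB by (field; lra). lra.
Qed.

Lemma Cmod_le_of_power_sums_linear (lam : nat -> C) (n : nat) (g a : R) :
  0 < g -> 0 <= a ->
  (forall m, (1 <= m <= n)%nat -> Cmod (power_sum lam n m) <= g * INR m * a ^ m) ->
  forall k, (1 <= k <= n)%nat -> Cmod (lam k) <= (1 + 2 * g) * a.
Proof.
  intros Hg Ha Hps k Hk. set (r := / (1 + 2 * g)).
  assert (Hr0 : 0 < r) by (apply Rinv_0_lt_compat; lra).
  assert (Hgr : g * r = (1 - r) / 2) by (unfold r; field; lra).
  apply (Cmod_le_of_no_unit_root lam); [apply Rmult_le_pos; lra|].
  intros c Hc HcB.
  apply (no_unit_root_linear (fun j => (c * lam j)%C) n g r); [lra|lra| | |exact Hk].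
  - assert (H : forall N, sum_f_R0
      (fun i => match i with O => 0 | S _ => g * r ^ i end) N = (1 - r ^ N) / 2).
    { induction N as [|N IH]; [simpl; lra|]. rewrite tech5, IH.
      simpl. rewrite <- Rmult_assoc, Hgr. field. }
    rewrite H. assert (0 < r ^ n) by (apply pow_lt; lra). lra.
  - intros m Hm. rewrite power_sum_scal, Cmod_mult, Cmod_pow.
    assert (Hcar : Cmod c * a <= r).
    { apply Rmult_le_reg_r with (1 + 2 * g); [lra|].
      unfold r. rewrite Rinv_l by lra. lra. }
    assert (Hpm : (Cmod c * a) ^ m <= r ^ m)
      by (apply pow_incr; split; [apply Rmult_le_pos; lra|exact Hcar]).
    rewrite Rpow_mult_distr in Hpm.
    assert (Hgm : 0 <= g * INR m) by (apply Rmult_le_pos; [lra|apply pos_INR]).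
    apply Rle_trans with (Cmod c ^ m * (g * INR m * a ^ m)).
    + apply Rmult_le_compat_l; [apply pow_le; lra|apply Hps, Hm].
    + replace (Cmod c ^ m * (g * INR m * a ^ m)) with (g * INR m * (Cmod c ^ m * a ^ m))
        by ring.
      apply Rmult_le_compat_l; assumption.
Qed.

Lemma max_Cmod_le (n : nat) (lam : nat -> C) (B : R) :
  0 <= B -> (forall k, (1 <= k <= n)%nat -> Cmod (lam k) <= B) -> max_Cmod n lam <= B.
Proof.
  intros HB H. unfold max_Cmod.
  assert (Hl : forall l, (forall k, In k l -> Cmod (lam k) <= B) ->
     MaxRlist (map (fun k => Cmod (lam k)) l) <= B).
  { intros l; induction l as [|k [|k' l] IH]; intros Hin; [exact HB|apply Hin; left; reflexivity|].
    apply Rmax_lub; [apply Hin; left; reflexivity|].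
    apply IH. intros j Hj. apply Hin. right. exact Hj. }
  apply Hl. intros k Hk. apply in_seq in Hk. apply H. lia.
Qed.

(** * The remainder *)

Lemma sum_const_C (x : C) (n : nat) :
  sum_n_m (G := C_AbelianMonoid) (fun _ => x) 1 n = (RtoC (INR n) * x)%C.
Proof.
  induction n as [|n IH].
  - rewrite sum_1_0. simpl. symmetry. apply Cmult_0_l.
  - rewrite sum_1_S, IH, S_INR, RtoC_plus.
    rewrite Cmult_plus_distr_r, Cmult_1_l. reflexivity.
Qed.

Lemma Cmod_sum_le (u : nat -> C) (n : nat) (x : R) :
  (forall k, (1 <= k <= n)%nat -> Cmod (u k) <= x) ->
  Cmod (sum_n_m (G := C_AbelianMonoid) u 1 n) <= INR n * x.
Proof.
  induction n as [|n IH]; intros H.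
  - rewrite sum_1_0, Cmod_0. simpl. lra.
  - rewrite sum_1_S.
    eapply Rle_trans; [apply Cmod_triangle|].
    specialize (IH ltac:(intros; apply H; lia)). specialize (H (S n) ltac:(lia)).
    rewrite S_INR. lra.
Qed.

Lemma csums_to_sum (u : nat -> nat -> C) (l : nat -> C) (n : nat) :
  (forall k, (1 <= k <= n)%nat -> csums_to (u k) (l k)) ->
  csums_to (fun m => sum_n_m (G := C_AbelianMonoid) (fun k => u k m) 1 n)
    (sum_n_m (G := C_AbelianMonoid) l 1 n).
Proof.
  induction n as [|n IH]; intros H.
  - rewrite sum_1_0.
    eapply csums_to_ext; [|apply (csums_to_zero_from (fun _ => 0%C)); reflexivity].
    intros m. symmetry. apply sum_1_0.
  - rewrite sum_1_S.
    eapply csums_to_ext; [|apply csums_to_plus; [apply IH; intros; apply H; lia|apply (H (S n)); lia]].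
    intros m. symmetry. apply sum_1_S.
Qed.

Lemma bounded_of_tail_le1 (hc : nat -> C) (n : nat) :
  tail_le1 hc n -> exists K, 0 <= K /\ forall m, Cmod (hc m) <= K.
Proof.
  intros H. exists (sum_f_R0 (fun m => Cmod (hc m)) n + 1).
  assert (Hs : 0 <= sum_f_R0 (fun m => Cmod (hc m)) n)
    by (apply sum_nonneg; intros; apply Cmod_ge_0).
  split; [lra|]. intros m. destruct (Nat.le_gt_cases m n) as [Hm|Hm].
  - assert (Cmod (hc m) <= sum_f_R0 (fun m => Cmod (hc m)) n); [|lra].
    clear H Hs. induction n as [|n IH].
    + replace m with O by lia. simpl. lra.
    + rewrite tech5. destruct (Nat.eq_dec m (S n)) as [->|Hne].
      * assert (0 <= sum_f_R0 (fun m => Cmod (hc m)) n); [|lra].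
        apply sum_nonneg; intros; apply Cmod_ge_0.
      * specialize (IH ltac:(lia)). pose proof (Cmod_ge_0 (hc (S n))). lra.
  - specialize (H m ltac:(lia)). lra.
Qed.

Lemma r_coef_mult (fc hc : nat -> C) :
  (forall m : nat, hc m = 0%C -> fc m = 0%C) ->
  forall m, fc m = (r_coef fc hc m * hc m)%C.
Proof.
  intros H m. unfold r_coef. destruct (Ceq_dec (fc m) 0) as [E|E]; [rewrite E; ring|].
  field. intros E'. apply E, H, E'.
Qed.

Lemma r_coef_0_neq (fc hc : nat -> C) :
  (forall m : nat, hc m = 0%C -> fc m = 0%C) -> fc 0%nat <> 0%C ->
  r_coef fc hc 0 <> 0%C.
Proof.
  intros H H0 E. apply H0. rewrite (r_coef_mult fc hc H 0), E. ring.
Qed.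

(** Taylor coefficients of the interpolating sum. *)
Definition H_coef (fc hc : nat -> C) (n : nat) (lam : nat -> C) (m : nat) : C :=
  (r_coef fc hc 0 / INR n * hc m
   * sum_n_m (G := C_AbelianMonoid) (fun k => (lam k ^ m)%C) 1 n)%C.

Lemma RtoC_INR_neq_0 (n : nat) : (1 <= n)%nat -> RtoC (INR n) <> 0%C.
Proof. intros Hn E. apply RtoC_inj in E. apply (not_0_INR n); [lia|exact E]. Qed.

Lemma H_coef_interpolates (fc hc : nat -> C) (n : nat) (lam : nat -> C) :
  (forall m : nat, hc m = 0%C -> fc m = 0%C) -> fc 0%nat <> 0%C ->
  (1 <= n)%nat -> is_Lambda fc hc n lam ->
  forall m, (m <= n)%nat -> H_coef fc hc n lam m = fc m.
Proof.
  intros Hfh Hf0 Hn HL m Hm.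
  pose proof (r_coef_0_neq fc hc Hfh Hf0) as Hr0.
  pose proof (RtoC_INR_neq_0 n Hn) as HnC.
  unfold H_coef. rewrite (r_coef_mult fc hc Hfh m).
  destruct m as [|m].
  - rewrite (sum_const_C 1%C n : sum_n_m (G := C_AbelianMonoid) (fun k => (lam k ^ 0)%C) 1 n = _).
    field. exact HnC.
  - rewrite (HL (S m) ltac:(lia)). field. split; assumption.
Qed.

Lemma H_coef_le (fc hc : nat -> C) (n : nat) (lam : nat -> C) (B : R) :
  (1 <= n)%nat -> (forall k, (1 <= k <= n)%nat -> Cmod (lam k) <= B) ->
  forall m, Cmod (H_coef fc hc n lam m)
    <= Cmod (r_coef fc hc 0) * Cmod (hc m) * B ^ m.
Proof.
  intros Hn HB m. pose proof (RtoC_INR_neq_0 n Hn) as HnC.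
  assert (Hn0 : 0 < INR n) by (apply lt_0_INR; lia).
  assert (HS : Cmod (sum_n_m (G := C_AbelianMonoid) (fun k => (lam k ^ m)%C) 1 n)
     <= INR n * B ^ m).
  { apply Cmod_sum_le. intros k Hk. rewrite Cmod_pow. apply pow_incr.
    split; [apply Cmod_ge_0|apply HB, Hk]. }
  unfold H_coef. rewrite !Cmod_mult, Cmod_div, Cmod_R, Rabs_pos_eq by (assumption || lra).
  apply Rle_trans with (Cmod (r_coef fc hc 0) / INR n * Cmod (hc m) * (INR n * B ^ m)).
  - apply Rmult_le_compat_l; [|exact HS].
    apply Rmult_le_pos; [|apply Cmod_ge_0].
    apply Rle_div_r; [exact Hn0|]. rewrite Rmult_0_l. apply Cmod_ge_0.
  - right. field. lra.
Qed.

(** [H_n] is the sum of its Taylor series wherever [B |z| < 1], all [|lam k|]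
    being at most [B]. *)
Lemma H_sum_series (fc hc : nat -> C) (h : C -> C) (n : nat) (lam : nat -> C)
    (B : R) (z : C) :
  sum_of_power_series hc h -> tail_le1 hc n ->
  (forall k, (1 <= k <= n)%nat -> Cmod (lam k) <= B) ->
  0 <= B -> B * Cmod z < 1 ->
  csums_to (fun m => (H_coef fc hc n lam m * z ^ m)%C) (H_sum fc hc h n lam z).
Proof.
  intros Hh Ht HB HB0 Hz.
  destruct (bounded_of_tail_le1 hc n Ht) as [K [HK0 HK]].
  pose proof (Cmod_ge_0 z) as Hz0.
  assert (Hk : forall k, (1 <= k <= n)%nat ->
     csums_to (fun m => (hc m * (lam k * z) ^ m)%C) (h (lam k * z)%C)).
  { intros k Hk.
    destruct (csums_to_geom_ex (fun m => (hc m * (lam k * z) ^ m)%C) K (B * Cmod z))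
      as [l Hl].
    - split; [apply Rmult_le_pos; lra|exact Hz].
    - intros m. rewrite Cmod_mult, Cmod_pow, Cmod_mult.
      apply Rmult_le_compat; [apply Cmod_ge_0| |apply HK|].
      + apply pow_le. apply Rmult_le_pos; apply Cmod_ge_0.
      + apply pow_incr. split; [apply Rmult_le_pos; apply Cmod_ge_0|].
        apply Rmult_le_compat_r; [exact Hz0|apply HB, Hk].
    - rewrite (proj2 Hh _ _ (proj1 (csums_to_is_pseries _ _ _) Hl)). exact Hl. }
  unfold H_sum. eapply csums_to_ext; [|apply csums_to_scal, csums_to_sum, Hk].
  intros m. unfold H_coef.
  assert (Hs : sum_n_m (G := C_AbelianMonoid) (fun k => (hc m * (lam k * z) ^ m)%C) 1 n
     = (hc m * z ^ m * sum_n_m (G := C_AbelianMonoid) (fun k => (lam k ^ m)%C) 1 n)%C).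
  { rewrite <- (sum_n_m_mult_l (K := C_Ring) (hc m * z ^ m)%C).
    apply sum_n_m_ext. intros k.
    change (hc m * (lam k * z) ^ m = hc m * z ^ m * lam k ^ m)%C.
    rewrite Cpow_mult_l. ring. }
  cbv beta. rewrite Hs. ring.
Qed.

Lemma analytic_H_sum (fc hc : nat -> C) (h : C -> C) (n : nat) (lam : nat -> C)
    (B : R) (D : C -> Prop) :
  sum_of_power_series hc h -> tail_le1 hc n -> (1 <= n)%nat ->
  (forall k, (1 <= k <= n)%nat -> Cmod (lam k) <= B) -> 0 <= B ->
  (forall z, D z -> B * Cmod z < 1) ->
  analytic_on D (H_sum fc hc h n lam).
Proof.
  intros Hh Ht Hn HB HB0 HD w Hw.
  destruct (bounded_of_tail_le1 hc n Ht) as [K [HK0 HK]].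
  apply (analytic_at_of_pseries (H_coef fc hc n lam) _ (Cmod (r_coef fc hc 0) * K) B).
  - apply Rmult_le_pos; [apply Cmod_ge_0|exact HK0].
  - exact HB0.
  - intros m. eapply Rle_trans; [apply (H_coef_le fc hc n lam B Hn HB)|].
    apply Rmult_le_compat_r; [apply pow_le, HB0|].
    apply Rmult_le_compat_l; [apply Cmod_ge_0|apply HK].
  - intros z Hz. apply (H_sum_series fc hc h n lam B z); assumption.
  - apply HD, Hw.
Qed.

(** The terms of degree at most [n] of [f - H_n] cancel; beyond degree [n]
    those of [f] and [H_n] are bounded by [c (B |z|)^m] and [(B |z|)^m] times
    [|r_0|]. *)
Lemma remainder_le (fc hc : nat -> C) (f h : C -> C) (n : nat) (lam : nat -> C)
    (B c : R) (z : C) :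
  sum_of_power_series fc f -> sum_of_power_series hc h ->
  fc 0%nat <> 0%C -> (forall m : nat, hc m = 0%C -> fc m = 0%C) ->
  (1 <= n)%nat -> is_Lambda fc hc n lam -> tail_le1 hc n ->
  0 <= B -> 0 <= c ->
  (forall k, (1 <= k <= n)%nat -> Cmod (lam k) <= B) ->
  (forall m, (n < m)%nat -> Cmod (r_coef fc hc m) <= Cmod (r_coef fc hc 0) * c * B ^ m) ->
  B * Cmod z < 1 ->
  Cmod (R_rem fc hc f h n lam z)
  <= Cmod (r_coef fc hc 0) * (1 + c) * (B * Cmod z) ^ (n + 1) / (1 - B * Cmod z).
Proof.
  intros Hf Hh Hf0 Hfh Hn HL Ht HB0 Hc HB Hr Hz.
  destruct (bounded_of_tail_le1 hc n Ht) as [K [HK0 HK]].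
  pose proof (Cmod_ge_0 z) as Hz0. pose proof (Cmod_ge_0 (r_coef fc hc 0)) as Hr0.
  pose proof (H_coef_interpolates fc hc n lam Hfh Hf0 Hn HL) as Hint.
  pose proof (H_coef_le fc hc n lam B Hn HB) as Hle.
  assert (Hq : 0 <= B * Cmod z < 1) by (split; [apply Rmult_le_pos; lra|exact Hz]).
  assert (Hfm : forall m, (n < m)%nat -> Cmod (fc m) <= Cmod (r_coef fc hc 0) * c * B ^ m).
  { intros m Hm. rewrite (r_coef_mult fc hc Hfh m), Cmod_mult.
    specialize (Ht m ltac:(lia)). specialize (Hr m Hm).
    pose proof (Cmod_ge_0 (r_coef fc hc m)). pose proof (Cmod_ge_0 (hc m)). nra. }
  assert (HBm : forall m, 0 <= B ^ m) by (intros; apply pow_le, HB0).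
  assert (Hfs : csums_to (fun m => (fc m * z ^ m)%C) (f z)).
  { destruct (csums_to_geom_ex (fun m => (fc m * z ^ m)%C)
      (Cmod (r_coef fc hc 0) * (K + c)) (B * Cmod z) Hq) as [l Hl].
    - intros m. rewrite Cmod_mult, Cmod_pow, Rpow_mult_distr, <- Rmult_assoc.
      apply Rmult_le_compat_r; [apply pow_le, Hz0|].
      destruct (Nat.le_gt_cases m n) as [Hm|Hm].
      + rewrite <- Hint by exact Hm. eapply Rle_trans; [apply Hle|].
        apply Rmult_le_compat_r; [apply HBm|].
        apply Rmult_le_compat_l; [exact Hr0|]. specialize (HK m). lra.
      + eapply Rle_trans; [apply Hfm, Hm|].
        apply Rmult_le_compat_r; [apply HBm|].
        apply Rmult_le_compat_l; [exact Hr0|]. lra.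
    - rewrite (proj2 Hf _ _ (proj1 (csums_to_is_pseries _ _ _) Hl)). exact Hl. }
  pose proof (H_sum_series fc hc h n lam B z Hh Ht HB HB0 Hz) as HHs.
  pose proof (csums_to_minus _ _ _ _ Hfs HHs) as HR. unfold R_rem. revert HR.
  apply csums_to_tail_le; [apply Rmult_le_pos; lra|exact Hq| |].
  - intros m Hm. rewrite Hint by exact Hm. ring.
  - intros m Hm.
    replace (fc m * z ^ m - H_coef fc hc n lam m * z ^ m)%C
      with ((fc m + - H_coef fc hc n lam m) * z ^ m)%C by ring.
    rewrite Cmod_mult, Cmod_pow, Rpow_mult_distr, <- Rmult_assoc.
    apply Rmult_le_compat_r; [apply pow_le, Hz0|].
    eapply Rle_trans; [apply Cmod_triangle|]. rewrite Cmod_opp.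
    specialize (Hfm m Hm). specialize (Hle m). specialize (Ht m ltac:(lia)).
    assert (Cmod (r_coef fc hc 0) * Cmod (hc m) * B ^ m <= Cmod (r_coef fc hc 0) * B ^ m).
    { apply Rmult_le_compat_r; [apply HBm|]. nra. }
    lra.
Qed.

(** * The case of all large [n] *)

(** A bound [O(1 / n)] that holds for all large [n] forces [r_m = 0] for
    [m >= 1]. *)
Lemma eq_0_of_le_div_INR (x : C) (X : R) (N : nat) :
  (forall n, (N <= n)%nat -> Cmod x <= X / INR n) -> x = 0%C.
Proof.
  intros H. apply Cmod_eq_0. destruct (Cmod_ge_0 x) as [Hx|Hx]; [exfalso|symmetry; exact Hx].
  destruct (INR_unbounded (X / Cmod x)) as [M HM].
  set (n := S (Nat.max M N)). specialize (H n ltac:(lia)).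
  assert (Hn0 : 0 < INR n) by (apply lt_0_INR; lia).
  assert (HMn : INR M <= INR n) by (apply le_INR; lia).
  apply Rmult_le_compat_r with (r := INR n) in H; [|lra].
  replace (X / INR n * INR n) with X in H by (field; lra).
  assert (HX : X / Cmod x < INR n) by lra.
  apply Rmult_lt_compat_r with (r := Cmod x) in HX; [|exact Hx].
  replace (X / Cmod x * Cmod x) with X in HX by (field; lra). lra.
Qed.

(** If [r_m = 0] for all [m >= 1], then all [lam k] vanish and both [f] and
    [H_n] equal the constant [f_0]. *)
Lemma H_sum_eq_of_constant (fc hc : nat -> C) (f h : C -> C) (n : nat) (lam : nat -> C) :
  sum_of_power_series fc f -> sum_of_power_series hc h ->
  fc 0%nat <> 0%C -> (forall m : nat, hc m = 0%C -> fc m = 0%C) ->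
  (1 <= n)%nat -> is_Lambda fc hc n lam ->
  (forall m, (1 <= m)%nat -> r_coef fc hc m = 0%C) ->
  forall z, H_sum fc hc h n lam z = f z.
Proof.
  intros Hf Hh Hf0 Hfh Hn HL Hr z.
  assert (Hlam : forall k, (1 <= k <= n)%nat -> lam k = 0%C).
  { intros k Hk. apply Cmod_eq_0. apply Rle_antisym; [|apply Cmod_ge_0].
    replace 0 with ((1 + 2 * 1) * 0) by ring.
    apply (Cmod_le_of_power_sums_linear lam n 1 0); [lra|lra| |exact Hk].
    intros [|m] Hm; [lia|]. unfold power_sum. rewrite (HL (S m) Hm), (Hr (S m)) by lia.
    rewrite Cmult_0_r, Cmod_0. simpl. lra. }
  assert (Hh0 : h 0%C = hc O).
  { apply (proj2 Hh). apply csums_to_is_pseries.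
    replace (hc O) with (hc O * 0 ^ 0)%C by (simpl; ring).
    apply (csums_to_zero_from (fun m => (hc m * 0 ^ m)%C)). intros m. simpl. ring. }
  assert (Hfz : f z = fc O).
  { apply (proj2 Hf). apply csums_to_is_pseries.
    replace (fc O) with (fc O * z ^ 0)%C by (simpl; ring).
    apply (csums_to_zero_from (fun m => (fc m * z ^ m)%C)). intros m.
    rewrite (r_coef_mult fc hc Hfh (S m)), (Hr (S m)) by lia. ring. }
  rewrite Hfz. unfold H_sum.
  rewrite (sum_n_m_ext_loc (G := C_AbelianMonoid) _ (fun _ => hc O)).
  - rewrite sum_const_C, (r_coef_mult fc hc Hfh 0). field. apply RtoC_INR_neq_0, Hn.
  - intros k Hk. rewrite Hlam by exact Hk. rewrite <- Hh0. f_equal. ring.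
Qed.

(** * Consequences of the bounds on [r_m] *)

Lemma disk_lt (c a : R) (z : C) :
  0 < c -> 0 <= a -> disk (/ c) a z -> c * a * Cmod z < 1.
Proof.
  intros Hc Ha Hz. destruct (Req_dec a 0) as [->|Hne]; [lra|].
  specialize (Hz Hne). apply Rmult_lt_compat_l with (r := c * a) in Hz;
    [|apply Rmult_lt_0_compat; lra].
  replace (c * a * (/ c * / a)) with 1 in Hz by (field; lra). exact Hz.
Qed.

Lemma Cmod_power_sum_Lambda (fc hc : nat -> C) (n : nat) (lam : nat -> C) (m : nat) (X : R) :
  r_coef fc hc 0 <> 0%C -> is_Lambda fc hc n lam -> (1 <= m <= n)%nat ->
  Cmod (r_coef fc hc m) <= Cmod (r_coef fc hc 0) / INR n * X ->
  Cmod (power_sum lam n m) <= X.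
Proof.
  intros Hr0 HL Hm Hr.
  assert (Hn0 : 0 < INR n) by (apply lt_0_INR; lia).
  assert (Hc0 : 0 < Cmod (r_coef fc hc 0)) by (apply Cmod_gt_0, Hr0).
  destruct m as [|m]; [lia|]. unfold power_sum. rewrite (HL (S m) Hm).
  rewrite Cmod_mult, Cmod_div, Cmod_R, Rabs_pos_eq by (assumption || lra).
  apply Rle_trans with (INR n / Cmod (r_coef fc hc 0) *
    (Cmod (r_coef fc hc 0) / INR n * X)).
  - apply Rmult_le_compat_l; [|exact Hr]. left. apply Rdiv_lt_0_compat; lra.
  - right. field. lra.
Qed.

(** The inequality required of [e] is the criterion of
    [no_unit_root_geometric] for [r = / (1 + e)]. *)
Lemma lam_bound_geometric (fc hc : nat -> C) (n : nat) (lam : nat -> C) (a e : R) :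
  r_coef fc hc 0 <> 0%C -> (2 <= n)%nat -> is_Lambda fc hc n lam -> 0 <= a ->
  r_bound_a fc hc n a -> 0 < e ->
  INR n < e * (1 + (INR n + 1) * e) * (1 + e) ^ (n - 1) ->
  forall k, (1 <= k <= n)%nat -> Cmod (lam k) <= (1 + e) * a.
Proof.
  intros Hr0 Hn HL Ha Hr He Hcond.
  rewrite <- (Rinv_inv (1 + e)). set (r := / (1 + e)).
  assert (Hr01 : 0 < r < 1).
  { unfold r. split; [apply Rinv_0_lt_compat; lra|].
    rewrite <- Rinv_1. apply Rinv_lt_contravar; lra. }
  apply Cmod_le_of_power_sums_geometric; [lia|exact Hr01|exact Ha| |].
  - assert (Hre : e * r = 1 - r) by (unfold r; field; lra).
    assert (Hr1 : (1 + e) * r = 1) by (unfold r; field; lra).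
    replace (n + 1)%nat with (2 + (n - 1))%nat by lia. rewrite pow_add.
    assert (Hp : 0 < r ^ (n - 1)) by (apply pow_lt; lra).
    assert (Hpp : (1 + e) ^ (n - 1) * r ^ (n - 1) = 1)
      by (rewrite <- Rpow_mult_distr, Hr1; apply pow1).
    apply Rlt_le_trans with (r ^ 2 *
      (e * (1 + (INR n + 1) * e) * (1 + e) ^ (n - 1)) * r ^ (n - 1)).
    + replace (INR n * (r ^ 2 * r ^ (n - 1))) with (r ^ 2 * INR n * r ^ (n - 1)) by ring.
      apply Rmult_lt_compat_r; [exact Hp|]. apply Rmult_lt_compat_l; [|exact Hcond].
      apply pow_lt; lra.
    + right.
      replace (r ^ 2 * (e * (1 + (INR n + 1) * e) * (1 + e) ^ (n - 1)) * r ^ (n - 1))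
        with ((e * r) * ((1 + e) * r + INR n * (e * r)) *
          ((1 + e) ^ (n - 1) * r ^ (n - 1))) by ring.
      rewrite Hpp, Hre, Hr1. ring.
  - intros m Hm. apply (Cmod_power_sum_Lambda fc hc n lam m _ Hr0 HL Hm). apply Hr. lia.
Qed.

(** Part (a) of the remainder estimate, for any admissible radius factor
    [1 + e]. *)
Lemma remainder_le_geometric (fc hc : nat -> C) (f h : C -> C) (n : nat)
    (lam : nat -> C) (a e : R) (z : C) :
  sum_of_power_series fc f -> sum_of_power_series hc h ->
  fc 0%nat <> 0%C -> (forall m : nat, hc m = 0%C -> fc m = 0%C) ->
  (1 <= n)%nat -> is_Lambda fc hc n lam -> tail_le1 hc n ->
  0 <= a -> r_bound_a fc hc n a -> 0 < e ->
  (forall k, (1 <= k <= n)%nat -> Cmod (lam k) <= (1 + e) * a) ->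
  (1 + e) * a * Cmod z < 1 ->
  Cmod (R_rem fc hc f h n lam z)
  <= Cmod (r_coef fc hc 0) * ((1 + e) ^ (n + 1) + / INR n) * (a * Cmod z) ^ (n + 1)
     / (1 - (1 + e) * a * Cmod z).
Proof.
  intros Hf Hh Hf0 Hfh Hn HL Ht Ha Hr He HB Hz.
  assert (Hn0 : 0 < INR n) by (apply lt_0_INR; lia).
  assert (Hp : forall m, 0 < (1 + e) ^ m) by (intros; apply pow_lt; lra).
  (* a^m / n = c B^m (1 + e)^(n + 1 - m) with B = (1 + e) a *)
  set (c := / INR n * / (1 + e) ^ (n + 1)).
  assert (Hc0 : 0 < / INR n) by (apply Rinv_0_lt_compat, Hn0).
  assert (Hc : 0 <= c).
  { unfold c. apply Rmult_le_pos; [lra|]. left. apply Rinv_0_lt_compat, Hp. }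
  eapply Rle_trans.
  { apply (remainder_le fc hc f h n lam ((1 + e) * a) c z); try assumption.
    - apply Rmult_le_pos; lra.
    - intros m Hm. eapply Rle_trans; [apply Hr; lia|].
      unfold Rdiv. rewrite !Rmult_assoc. apply Rmult_le_compat_l; [apply Cmod_ge_0|].
      unfold c. rewrite Rmult_assoc. apply Rmult_le_compat_l; [lra|].
      rewrite Rpow_mult_distr. replace m with ((n + 1) + (m - (n + 1)))%nat at 2 by lia.
      rewrite (pow_add (1 + e) (n + 1) (m - (n + 1))). pose proof (Hp (n + 1)%nat).
      replace (/ (1 + e) ^ (n + 1) * ((1 + e) ^ (n + 1) * (1 + e) ^ (m - (n + 1)) * a ^ m))
        with ((1 + e) ^ (m - (n + 1)) * a ^ m) by (field; lra).
      assert (1 <= (1 + e) ^ (m - (n + 1))) by (apply pow_R1_Rle; lra).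
      assert (0 <= a ^ m) by (apply pow_le, Ha). nra. }
  right. unfold Rdiv. f_equal. unfold c.
  rewrite Rmult_assoc, (Rmult_assoc (Cmod _)). f_equal.
  replace ((1 + e) * a * Cmod z) with ((1 + e) * (a * Cmod z)) by ring.
  rewrite (Rpow_mult_distr (1 + e)). specialize (Hp (n + 1)%nat). field. lra.
Qed.

Theorem theorem4 (fc hc : nat -> C) (f h : C -> C)
    (Hf : sum_of_power_series fc f)
    (Hh : sum_of_power_series hc h)
    (Hf0 : fc 0%nat <> 0%C)
    (Hfh : forall m : nat, hc m = 0%C -> fc m = 0%C) :
  (* (a) *)
  ((forall (n : nat) (lam : nat -> C) (a : R),
      (2 <= n)%nat -> is_Lambda fc hc n lam -> tail_le1 hc n ->
      0 <= a -> r_bound_a fc hc n a ->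
      max_Cmod n lam <= (1 + eps_ n) * a
      /\ analytic_on (disk (/ (1 + eps_ n)) a) (H_sum fc hc h n lam)
      /\ (forall z : C, disk (/ (1 + eps_ n)) a z ->
            Cmod (R_rem fc hc f h n lam z)
            <= 2 * Cmod (r_coef fc hc 0) * INR n ^ 2 * Cmod (a * z)%C ^ (n + 1)
               / (1 - (1 + eps_ n) * a * Cmod z)))
   /\
   (forall (Lam : nat -> nat -> C) (a : R),
      (forall n : nat, (1 <= n)%nat -> is_Lambda fc hc n (Lam n)) ->
      0 <= a ->
      (exists N : nat, forall n : nat, (N <= n)%nat ->
         tail_le1 hc n /\ r_bound_a fc hc n a) ->
      unif_cvg_on (disk 1 a) (fun n => H_sum fc hc h n (Lam n)) f))
  /\
  (* (b) *)
  ((forall (n : nat) (lam : nat -> C) (gamma a : R),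
      (1 <= n)%nat -> is_Lambda fc hc n lam -> tail_le1 hc n ->
      0 < gamma -> 0 <= a -> r_bound_b fc hc n gamma a ->
      max_Cmod n lam <= (1 + 2 * gamma) * a
      /\ analytic_on (disk (/ (1 + 2 * gamma)) a) (H_sum fc hc h n lam)
      /\ ((2 <= n)%nat ->
          forall z : C, disk (/ (1 + 2 * gamma)) a z ->
            Cmod (R_rem fc hc f h n lam z)
            <= 2 * Cmod (r_coef fc hc 0)
               * Cmod (RtoC ((1 + 2 * gamma) * a) * z)%C ^ (n + 1)
               / (1 - (1 + 2 * gamma) * a * Cmod z) ^ 2))
   /\
   (forall (Lam : nat -> nat -> C) (gamma a : R),
      (forall n : nat, (1 <= n)%nat -> is_Lambda fc hc n (Lam n)) ->
      0 < gamma -> 0 <= a ->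
      (exists N : nat, forall n : nat, (N <= n)%nat ->
         tail_le1 hc n /\ r_bound_b fc hc n gamma a) ->
      unif_cvg_on (disk (/ (1 + 2 * gamma)) a)
        (fun n => H_sum fc hc h n (Lam n)) f)).
Proof.
  pose proof (r_coef_0_neq fc hc Hfh Hf0) as Hr0.
  pose proof (Cmod_ge_0 (r_coef fc hc 0)) as Hr0'.
  assert (Hconst : forall (Lam : nat -> nat -> C) (D : C -> Prop),
    (forall n : nat, (1 <= n)%nat -> is_Lambda fc hc n (Lam n)) ->
    (forall m, (1 <= m)%nat -> r_coef fc hc m = 0%C) ->
    unif_cvg_on D (fun n => H_sum fc hc h n (Lam n)) f).
  { intros Lam D HL Hr eps Heps. exists 1%nat. intros n Hn z _.
    rewrite (H_sum_eq_of_constant fc hc f h n (Lam n)); auto.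
    replace (f z - f z)%C with (RtoC 0) by ring. rewrite Cmod_0. exact Heps. }
  split; split.
  - intros n lam a Hn HL Ht Ha Hr.
    pose proof (eps_ge n Hn) as Hge.
    assert (Hn0 : 2 <= INR n) by (apply (le_INR 2) in Hn; simpl in Hn; lra).
    assert (He0 : 0 < eps_ n).
    { eapply Rlt_le_trans; [|exact Hge]. apply Rdiv_lt_0_compat; lra. }
    assert (HB : forall k, (1 <= k <= n)%nat -> Cmod (lam k) <= (1 + eps_ n) * a).
    { apply (lam_bound_geometric fc hc); try assumption. apply eps_condition, Hn. }
    assert (HB0 : 0 <= (1 + eps_ n) * a) by (apply Rmult_le_pos; lra).
    assert (Hd : forall z, disk (/ (1 + eps_ n)) a z -> (1 + eps_ n) * a * Cmod z < 1).
    { intros z. apply disk_lt; lra. }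
    split; [apply max_Cmod_le; assumption|].
    split; [apply (analytic_H_sum fc hc h n lam ((1 + eps_ n) * a)); auto; lia|].
    intros z Hz. specialize (Hd z Hz).
    rewrite Cmod_mult, Cmod_R, Rabs_pos_eq by exact Ha.
    pose proof (Cmod_ge_0 z) as Hz0.
    assert (Haz : 0 <= a * Cmod z) by (apply Rmult_le_pos; assumption).
    assert (Hazp : 0 <= (a * Cmod z) ^ (n + 1)) by (apply pow_le; exact Haz).
    (* for n = 2 the power (1 + eps_ 2)^3 is too large; the root criterion already
       holds with 0.7 in place of eps_ 2 *)
    assert (Hex : exists e, 0 < e <= eps_ n
      /\ (forall k, (1 <= k <= n)%nat -> Cmod (lam k) <= (1 + e) * a)
      /\ (1 + e) ^ (n + 1) + / INR n <= 2 * INR n ^ 2).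
    { destruct (Nat.eq_dec n 2) as [->|Hne].
      - exists 0.7. simpl in Hge. split; [lra|]. split; [|simpl; lra].
        apply (lam_bound_geometric fc hc); try assumption; [lra|simpl; lra].
      - exists (eps_ n). split; [lra|]. split; [exact HB|].
        apply eps_power_upper. lia. }
    destruct Hex as [e [He [HBe Hpow]]].
    assert (Hde : (1 + e) * a * Cmod z <= (1 + eps_ n) * a * Cmod z).
    { rewrite !Rmult_assoc. apply Rmult_le_compat_r; lra. }
    eapply Rle_trans;
      [apply (remainder_le_geometric fc hc f h n lam a e z); try assumption; lia || lra|].
    apply Rmult_le_compat.
    + apply Rmult_le_pos; [|exact Hazp]. apply Rmult_le_pos; [exact Hr0'|].
      apply Rplus_le_le_0_compat; [apply pow_le; lra|].
      left. apply Rinv_0_lt_compat. lra.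
    + left. apply Rinv_0_lt_compat. lra.
    + apply Rmult_le_compat_r; [exact Hazp|].
      replace (2 * Cmod (r_coef fc hc 0) * INR n ^ 2)
        with (Cmod (r_coef fc hc 0) * (2 * INR n ^ 2)) by ring.
      apply Rmult_le_compat_l; [exact Hr0'|exact Hpow].
    + apply Rinv_le_contravar; lra.
  - intros Lam a HL Ha [N HN]. apply Hconst; [exact HL|]. intros m Hm.
    apply (eq_0_of_le_div_INR _ (Cmod (r_coef fc hc 0) * a ^ m) N). intros n Hn.
    destruct (HN n Hn) as [_ Hr]. eapply Rle_trans; [apply Hr, Hm|].
    right. unfold Rdiv. ring.
  - intros n lam g a Hn HL Ht Hg Ha Hr.
    assert (Hn0 : 1 <= INR n) by (apply (le_INR 1) in Hn; simpl in Hn; lra).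
    assert (HB : forall k, (1 <= k <= n)%nat -> Cmod (lam k) <= (1 + 2 * g) * a).
    { apply Cmod_le_of_power_sums_linear; [exact Hg|exact Ha|]. intros m Hm.
      apply (Cmod_power_sum_Lambda fc hc n lam m _ Hr0 HL Hm).
      rewrite <- !Rmult_assoc. apply Hr. lia. }
    assert (HB0 : 0 <= (1 + 2 * g) * a) by (apply Rmult_le_pos; lra).
    assert (Hd : forall z, disk (/ (1 + 2 * g)) a z -> (1 + 2 * g) * a * Cmod z < 1).
    { intros z. apply disk_lt; lra. }
    split; [apply max_Cmod_le; assumption|].
    split; [apply (analytic_H_sum fc hc h n lam ((1 + 2 * g) * a)); auto|].
    intros _ z Hz. specialize (Hd z Hz).
    rewrite Cmod_mult, Cmod_R, Rabs_pos_eq by exact HB0.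
    set (w := (1 + 2 * g) * a * Cmod z) in *.
    assert (Hw : 0 <= w) by (apply Rmult_le_pos; [exact HB0|apply Cmod_ge_0]).
    assert (Hwp : 0 <= w ^ (n + 1)) by (apply pow_le; exact Hw).
    eapply Rle_trans.
    { apply (remainder_le fc hc f h n lam ((1 + 2 * g) * a) (1 / 2) z); try assumption;
        [lra|]. intros m Hm.
      eapply Rle_trans; [apply Hr; lia|].
      (* Bernoulli: 2 g m <= (1 + 2 g)^m *)
      pose proof (poly m (2 * g) ltac:(lra)) as Hb.
      unfold Rdiv. rewrite !Rmult_assoc. apply Rmult_le_compat_l; [exact Hr0'|].
      rewrite Rpow_mult_distr.
      assert (H1 : / INR n <= 1) by (rewrite <- Rinv_1; apply Rinv_le_contravar; lra).
      assert (H2 : 0 < / INR n) by (apply Rinv_0_lt_compat; lra).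
      assert (H3 : 0 <= a ^ m) by (apply pow_le, Ha).
      assert (H4 : 0 <= g * (INR m * a ^ m)).
      { apply Rmult_le_pos; [lra|]. apply Rmult_le_pos; [apply pos_INR|exact H3]. }
      apply Rle_trans with (g * (INR m * a ^ m)); [nra|].
      rewrite <- !Rmult_assoc. apply Rmult_le_compat_r; [exact H3|]. lra. }
    fold w. unfold Rdiv.
    replace (2 * Cmod (r_coef fc hc 0) * w ^ (n + 1) * / (1 - w) ^ 2)
      with (Cmod (r_coef fc hc 0) * w ^ (n + 1) * / (1 - w) * (2 * / (1 - w)))
      by (field; lra).
    replace (Cmod (r_coef fc hc 0) * (1 + 1 * / 2) * w ^ (n + 1) * / (1 - w))
      with (Cmod (r_coef fc hc 0) * w ^ (n + 1) * / (1 - w) * (3 / 2)) by (field; lra).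
    apply Rmult_le_compat_l.
    + apply Rmult_le_pos; [apply Rmult_le_pos; assumption|].
      left. apply Rinv_0_lt_compat. lra.
    + assert (1 <= / (1 - w)) by (rewrite <- Rinv_1 at 1; apply Rinv_le_contravar; lra).
      lra.
  - intros Lam g a HL Hg Ha [N HN]. apply Hconst; [exact HL|]. intros m Hm.
    apply (eq_0_of_le_div_INR _ (Cmod (r_coef fc hc 0) * g * INR m * a ^ m) N). intros n Hn.
    destruct (HN n Hn) as [_ Hr]. eapply Rle_trans; [apply Hr, Hm|].
    right. unfold Rdiv. ring.
Qed.
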